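(* Let $\mathcal{H}$ be a finite family of connected graphs. (i) There exists a constant $c(\mathcal{H})$ such that $\mathrm{inspc}(G)\le c(\mathcal{H})$ for every connected $\mathcal{H}$-free graph $G$ if and only if $\mathcal{H}\le \{K_n,S^*_n,F^{(1)}_n,F^{(2)}_n,F^{(3)}_n\}$ for some integer $n\ge 4$. (ii) There exists a constant $c(\mathcal{H})$ such that $\mathrm{inspp}(G)\le c(\mathcal{H})$ for every connected $\mathcal{H}$-free graph $G$ if and only if $\mathcal{H}\le \{K_n,S^*_n,\tilde S_n,F^{(1)}_n,F^{(2)}_n,F^{(4)}_n,F^{(5)}_n\}$ for some integer $n\ge 4$.
   Context: All graphs are finite, simple, undirected. A graph $G$ is $H$-free if $G$ contains no induced subgraph isomorphic to $H$; for a family $\mathcal{H}$, $G$ is $\mathcal{H}$-free if it is $H$-free for every $H\in\mathcal{H}$. For families $\mathcal{H}_1,\mathcal{H}_2$, write $\mathcal{H}_1\le\mathcal{H}_2$ if every $H_2\in\mathcal{H}_2$ contains an induced subgraph isomorphic to some element of $\mathcal{H}_1$. $K_n$ is the complete graph of order $n$, $K_{1,n}$ the star of order $n+1$, $P_n$ the path of order $n$. An induced SP-cover of $G$ is a family $\mathcal{P}$ of induced subgraphs of $G$, each isomorphic to some $K_{1,m}$ ($m\ge1$) or some $P_m$ ($m\ge1$), with $\bigcup_{P\in\mathcal{P}}V(P)=V(G)$; it is an induced SP-partition if its members are pairwise vertex-disjoint. $\mathrm{inspc}(G)$ (resp. $\mathrm{inspp}(G)$) is the minimum cardinality of an induced SP-cover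 (resp. induced SP-partition) of $G$. For $n\ge2$ let $A=\{x_i,y_i,z_i:1\le i\le n\}$. $S^*_n$: vertex set $A\setminus\{x_i:2\le i\le n\}$, edges $\{x_1y_i,\,y_iz_i:1\le i\le n\}$. $\tilde S_n$: $S^*_n$ plus the edges $x_1z_i$ ($1\le i\le n$). $F^{(1)}_n$: vertex set $A\setminus\{x_i:3\le i\le n\}$, edges $\{x_1x_2,x_1y_1,x_1z_1\}\cup\{y_iy_{i+1},z_iz_{i+1}:1\le i\le n-1\}$. $F^{(2)}_n$: vertex set $A\setminus\{x_i:2\le i\le n\}$, edges $\{x_1y_1,x_1z_1,y_1z_1\}\cup\{y_iy_{i+1},z_iz_{i+1}:1\le i\le n-1\}$. $F^{(3)}_n$: vertex set $A$, edges $\{x_iy_1,x_iz_1:1\le i\le n\}\cup\{y_iy_{i+1},z_iz_{i+1}:1\le i\le n-1\}$. $F^{(4)}_n$: $F^{(3)}_n$ with the vertices $x_i$ ($3\le i\le n$) deleted. $F^{(5)}_n$: $F^{(4)}_n$ plus the edge $x_1x_2$. *)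

(* Defs.v *)
From Stdlib Require List.
From HB Require Import structures.
From mathcomp Require Import all_boot.
From mathcomp Require Import boolp.

Set Implicit Arguments.
Unset Strict Implicit.
Unset Printing Implicit Defensive.

Record sgraph := SGraph {
  vert :> finType;
  adj : rel vert;
  adj_sym : symmetric adj;
  adj_irr : irreflexive adj }.

Definition connected (G : sgraph) : Prop :=
  0 < #|G| /\ forall x y : G, connect (@adj G) x y.

Definition iso (G H : sgraph) : Prop :=
  exists f : G -> H,
    bijective f /\ forall x y : G, adj (f x) (f y) = adj x y.

Section Induced.
Variables (G : sgraph) (S : {set G}).

Definition induced_adj : rel {x : G | x \in S} :=
  [rel x y | adj (val x) (val y)].

Fact induced_sym : symmetric induced_adj.
Proof. by move=> x y; apply: adj_sym. Qed.

Fact induced_irr : irreflexive induced_adj.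
Proof. by move=> x; apply: adj_irr. Qed.

Definition induced : sgraph := SGraph induced_sym induced_irr.
End Induced.

Definition contains_induced (G H : sgraph) : Prop :=
  exists S : {set G}, iso (induced S) H.

Definition family_free (Hs : seq sgraph) (G : sgraph) : Prop :=
  forall H, List.In H Hs -> ~ contains_induced G H.

Definition family_le (Hs1 Hs2 : seq sgraph) : Prop :=
  forall H2, List.In H2 Hs2 ->
    exists2 H1, List.In H1 Hs1 & contains_induced H2 H1.

Section OfRel.
Variables (T : finType) (e : rel T).

Definition rel_adj : rel T := [rel u v | (u != v) && (e u v || e v u)].

Fact rel_adj_sym : symmetric rel_adj.
Proof. by move=> u v; rewrite /rel_adj /= eq_sym orbC. Qed.

Fact rel_adj_irr : irreflexive rel_adj.
Proof. by move=> u; rewrite /rel_adj /= eqxx. Qed.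

(* The edges are the unordered pairs uv, u != v, with e u v or e v u. *)
Definition graph_of_rel : sgraph := SGraph rel_adj_sym rel_adj_irr.
End OfRel.

Definition complete_graph (n : nat) : sgraph :=
  graph_of_rel [rel i j : 'I_n | true].

(* K_{1,n}: None is the centre. *)
Definition star_graph (n : nat) : sgraph :=
  graph_of_rel [rel u v : option 'I_n | (u == None) && (v != None)].

Definition path_graph (n : nat) : sgraph :=
  graph_of_rel [rel i j : 'I_n | i.+1 == j].

Definition is_star (G : sgraph) : Prop :=
  exists2 m, 1 <= m & iso G (star_graph m).

Definition is_path (G : sgraph) : Prop :=
  exists2 m, 1 <= m & iso G (path_graph m).

(* An induced subgraph is given by its vertex set. *)
Definition induced_sp_cover (G : sgraph) (P : {set {set G}}) : Prop :=
  (forall S, S \in P -> is_star (induced S) \/ is_path (induced S)) /\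
  cover P = [set: G].

Definition induced_sp_partition (G : sgraph) (P : {set {set G}}) : Prop :=
  induced_sp_cover P /\ trivIset P.

Lemma induced1_is_path (G : sgraph) (x : G) : is_path (induced [set x]).
Proof.
exists 1 => //; exists (fun=> ord0); split; last first.
  move=> [y yx] [z zx]; rewrite /= /induced_adj /=.
  by rewrite (set1P yx) (set1P zx) adj_irr.
exists (fun=> exist _ x (set11 x)) => [[y yx]|i]; last by rewrite ord1.
by apply: val_inj; rewrite /= (set1P yx).
Qed.

Lemma induced_sp_partition_ex (G : sgraph) :
  exists P : {set {set G}}, induced_sp_partition P.
Proof.
exists [set [set x] | x in G]; split; [split|].
- by move=> _ /imsetP[x _ ->]; right; apply: induced1_is_path.
- apply/setP=> x; rewrite inE; apply/bigcupP.
  by exists [set x]; rewrite ?set11 // imset_f.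
- apply/trivIsetP => _ _ /imsetP[x _ ->] /imsetP[y _ ->] neq.
  by rewrite disjoints1 inE; apply: contraNneq neq => ->.
Qed.

Definition has_sp_cover (G : sgraph) : pred nat :=
  fun k => `[< exists2 P : {set {set G}}, induced_sp_cover P & #|P| = k >].

Definition has_sp_partition (G : sgraph) : pred nat :=
  fun k => `[< exists2 P : {set {set G}}, induced_sp_partition P & #|P| = k >].

Fact has_sp_cover_ex (G : sgraph) : exists k, has_sp_cover G k.
Proof.
have [P [PC _]] := induced_sp_partition_ex G.
by exists #|P|; apply/asboolP; exists P.
Qed.

Fact has_sp_partition_ex (G : sgraph) : exists k, has_sp_partition G k.
Proof.
have [P PP] := induced_sp_partition_ex G.
by exists #|P|; apply/asboolP; exists P.
Qed.

Definition inspc (G : sgraph) : nat := ex_minn (has_sp_cover_ex G).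
Definition inspp (G : sgraph) : nat := ex_minn (has_sp_partition_ex G).

(* The labels x_i, y_i, z_i, indexed from 0: X i with i : 'I_n is x_{i+1}. *)
Variant label (n : nat) := X of 'I_n | Y of 'I_n | Z of 'I_n.

Section LabelFinite.
Variable n : nat.

Definition sum_of_label (v : label n) : 'I_n + 'I_n + 'I_n :=
  match v with X i => inl (inl i) | Y i => inl (inr i) | Z i => inr i end.

Definition label_of_sum (s : 'I_n + 'I_n + 'I_n) : label n :=
  match s with inl (inl i) => X i | inl (inr i) => Y i | inr i => Z i end.

Fact sum_of_labelK : cancel sum_of_label label_of_sum.
Proof. by case. Qed.

HB.instance Definition _ := Finite.copy (label n) (can_type sum_of_labelK).
End LabelFinite.

(* All labels except the x_i with i > k (1-based i). *)
Definition first_x (n k : nat) : {set label n} :=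
  [set v | if v is X i then i < k else true].

Definition Sstar_rel (n : nat) : rel (label n) := fun u v =>
  match u, v with
  | X i, Y _ => i == 0 :> nat
  | Y i, Z j => i == j
  | _, _ => false
  end.

Definition Sstar (n : nat) : sgraph :=
  @induced (graph_of_rel (@Sstar_rel n)) (first_x n 1).

Definition Stilde_rel (n : nat) : rel (label n) := fun u v =>
  Sstar_rel u v || (if (u, v) is (X i, Z _) then i == 0 :> nat else false).

Definition Stilde (n : nat) : sgraph :=
  @induced (graph_of_rel (@Stilde_rel n)) (first_x n 1).

(* The edges y_i y_{i+1} and z_i z_{i+1}, 1 <= i <= n - 1. *)
Definition legs_rel (n : nat) : rel (label n) := fun u v =>
  match u, v with
  | Y i, Y j | Z i, Z j => i.+1 == j
  | _, _ => false
  end.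

Definition F1_rel (n : nat) : rel (label n) := fun u v =>
  legs_rel u v ||
  match u, v with
  | X i, X j => (i == 0 :> nat) && (j == 1 :> nat)
  | X i, Y j | X i, Z j => (i == 0 :> nat) && (j == 0 :> nat)
  | _, _ => false
  end.

Definition F1 (n : nat) : sgraph :=
  @induced (graph_of_rel (@F1_rel n)) (first_x n 2).

Definition F2_rel (n : nat) : rel (label n) := fun u v =>
  legs_rel u v ||
  match u, v with
  | X i, Y j | X i, Z j | Y i, Z j => (i == 0 :> nat) && (j == 0 :> nat)
  | _, _ => false
  end.

Definition F2 (n : nat) : sgraph :=
  @induced (graph_of_rel (@F2_rel n)) (first_x n 1).

Definition F3_rel (n : nat) : rel (label n) := fun u v =>
  legs_rel u v ||
  match u, v with
  | X _, Y j | X _, Z j => j == 0 :> nat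
  | _, _ => false
  end.

Definition F3 (n : nat) : sgraph := graph_of_rel (@F3_rel n).

Definition F4 (n : nat) : sgraph := @induced (F3 n) (first_x n 2).

Definition F5_rel (n : nat) : rel (label n) := fun u v =>
  F3_rel u v ||
  (if (u, v) is (X i, X j) then (i == 0 :> nat) && (j == 1 :> nat) else false).

Definition F5 (n : nat) : sgraph :=
  @induced (graph_of_rel (@F5_rel n)) (first_x n 2).

(* Main.v *)
(* Sufficiency.  In a connected graph G without induced K_n and S*_n, every ball
   of bounded radius is dominated by boundedly many vertices: a minimal dominating
   subset of a neighbourhood has private neighbours, and Ramsey's theorem extracts
   an S*_n.  If moreover F1_n and F2_n are excluded, a vertex attached to the middle
   of a geodesic p from a root is a twin of some p_j, adjacent to p_(j-1) and
   p_(j+1); twins of p_j and p_(j+1) are adjacent and have no other neighbours than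
   twins, so they form a tube around p.  Hence G is the union of boundedly many
   tubes and of a set dominated by boundedly many vertices.  For covers, F3_n bounds
   the number of twins of each p_j, so that a tube is a union of boundedly many
   induced paths, and the chromatic number of G is bounded by induction on the
   clique number; a dominated set is then covered by boundedly many stars.  For
   partitions, F4_n and F5_n make every tube a path, and a neighbourhood is split
   into stars by means of a maximal induced matching, which is small by Stilde_n.

   Necessity.  K_n, S*_n and Stilde_n themselves need many stars and paths.  For the
   other graphs F, many copies of F are strung into a chain which needs many stars
   and paths, while a small connected induced subgraph of it already lies in F. *)
Require Import Defs.
From Stdlib Require List.
From mathcomp Require Import all_boot.
From mathcomp Require Import boolp zify.

Set Implicit Arguments.
Unset Strict Implicit.
Unset Printing Implicit Defensive.

(** * Embeddings and Ramsey's theorem *)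

(** Geodesics are controlled only far from both ends, so their ends must fall into dominated balls.
    The number of tubes stays bounded because the level where they begin is dominated by a bounded
    set, and one geodesic per dominating vertex is enough. Twins are handled by rerouting: a
    geodesic with one vertex replaced by a twin is again a geodesic, so the rule on attached
    vertices applies to it as well. Stars of a cover may share their centre, so a proper colouring
    of a neighbourhood splits it into stars. In a partition a centre is spent once: what one star
    leaves of a neighbourhood needs new centres, and a dominating vertex that lies on a tube is lost
    as a centre. For necessity, finiteness of the family provides an n above the order of all its
    members, which is what makes them too short to cross a leg of the chain. The lower bounds mostly
    single out vertices that can only be ends of a path, at most two per path, while a star touches
    such vertices in one gadget only. For [F3] no such vertices exist, and the many x of each gadget
    are counted instead. *)

Definition embeds (H G : sgraph) : Prop :=
  exists g : H -> G, injective g /\ {mono g : x y / adj x y}.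

Lemma iso_sym G H : iso G H -> iso H G.
Proof.
case=> f [[g fK gK] fadj]; exists g; split; first by exists f.
by move=> x y; rewrite -fadj !gK.
Qed.

Lemma iso_image (G H : sgraph) (g : H -> G) :
  injective g -> {mono g : x y / adj x y} -> iso (induced (g @: setT)) H.
Proof.
move=> gI gA; apply: iso_sym.
have gS x : g x \in g @: setT by apply: imset_f.
exists (fun x => exist _ (g x) (gS x)); split; last by move=> x y; apply: gA.
apply: inj_card_bij => [x y [] /gI //|].
by rewrite card_sig card_imset // cardsT.
Qed.

Lemma contains_embeds (G H : sgraph) : contains_induced G H <-> embeds H G.
Proof.
split=> [[S /iso_sym[f [fB fA]]]|[g [gI gA]]]; last first.
  by exists (g @: setT); apply: iso_image.
exists (val \o f); split=> [x y /= /val_inj /(bij_inj fB) //|x y /=].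
exact: fA.
Qed.

Lemma embeds_trans H1 H2 H3 : embeds H1 H2 -> embeds H2 H3 -> embeds H1 H3.
Proof.
case=> f [fI fA] [g [gI gA]]; exists (g \o f); split; first exact: inj_comp.
by move=> x y /=; rewrite gA fA.
Qed.

Lemma embeds_induced (G : sgraph) (S : {set G}) : embeds (induced S) G.
Proof. by exists val; split=> //; apply: val_inj. Qed.

Lemma embeds_into (H G : sgraph) (S : {set G}) (g : H -> G) :
  injective g -> {mono g : x y / adj x y} -> (forall x, g x \in S) ->
  embeds H (induced S).
Proof.
move=> gI gA gS; exists (fun x => exist _ (g x) (gS x)).
by split=> [x y []/gI|x y] //; apply: gA.
Qed.

Section Labels.
Variable n : nat.
Implicit Types i j : 'I_n.


Lemma eqXX i j : (X i == X j) = (i == j :> nat). Proof. by []. Qed.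
Lemma eqYY i j : (Y i == Y j) = (i == j :> nat). Proof. by []. Qed.
Lemma eqZZ i j : (Z i == Z j) = (i == j :> nat). Proof. by []. Qed.
Lemma eqXY i j : (X i == Y j) = false. Proof. by []. Qed.
Lemma eqXZ i j : (X i == Z j) = false. Proof. by []. Qed.
Lemma eqYX i j : (Y i == X j) = false. Proof. by []. Qed.
Lemma eqYZ i j : (Y i == Z j) = false. Proof. by []. Qed.
Lemma eqZX i j : (Z i == X j) = false. Proof. by []. Qed.
Lemma eqZY i j : (Z i == Y j) = false. Proof. by []. Qed.

(** [g] is a total function although some [X i] are deleted; its values there are arbitrary, hence
    the restriction of both conditions to [first_x n k]. *)
Lemma embeds_labels (F : rel (label n)) k (G : sgraph) (g : label n -> G) :
  {in first_x n k &, injective g} ->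
  {in first_x n k &, forall u v, adj (g u) (g v) = rel_adj F u v} ->
  embeds (@induced (graph_of_rel F) (first_x n k)) G.
Proof.
move=> gI gA; exists (g \o val); split=> [[x xS] [y yS] /= e|[x xS] [y yS]] /=.
  by apply: val_inj => /=; apply: gI.
by rewrite gA.
Qed.

End Labels.

Definition labE := (eqXX, eqYY, eqZZ, eqXY, eqXZ, eqYX, eqYZ, eqZX, eqZY).

Lemma rel_adjE (T : finType) (e : rel T) u v :
  rel_adj e u v = (u != v) && (e u v || e v u).
Proof. by []. Qed.

Definition clique (G : sgraph) (A : {set G}) :=
  {in A &, forall x y, x != y -> adj x y}.

Definition stable (G : sgraph) (A : {set G}) :=
  {in A &, forall x y, ~~ adj x y}.

Lemma embeds_clique (G : sgraph) (A : {set G}) :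
  clique A -> embeds (complete_graph #|A|) G.
Proof.
move=> cA; exists (fun i : 'I_#|A| => enum_val i); split; first exact: enum_val_inj.
move=> i j; rewrite /= /rel_adj /= andbT.
have [->|ne] := eqVneq i j; first exact: adj_irr.
by apply: cA; rewrite ?enum_valP // (inj_eq enum_val_inj).
Qed.

(** Induction on a + b: without [x], the set splits into [N] and [M] with #|N| + #|M| + 1 at least
    2^(m+1), so one of them has 2^m elements. A general symmetric relation is allowed because
    vertices will also be compared through their private neighbours. *)
Lemma ramsey (T : finType) (e : rel T) : symmetric e ->
  forall a b (S : {set T}), 2 ^ (a + b) <= #|S| ->
  exists2 A : {set T}, A \subset S &
    (#|A| = a /\ {in A &, forall x y, x != y -> e x y}) \/
    (#|A| = b /\ {in A &, forall x y, x != y -> ~~ e x y}).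
Proof.
move=> esym a b; move: {-1}(a + b) (erefl (a + b)) => m.
elim: m a b => [|m IH] a b mE S cS.
  exists set0; rewrite ?sub0set //; left; rewrite cards0; split; first by lia.
  by move=> x; rewrite inE.
case: a mE => [|a] mE.
  exists set0; rewrite ?sub0set //; left; rewrite cards0; split=> //.
  by move=> x; rewrite inE.
case: b mE => [|b] mE.
  exists set0; rewrite ?sub0set //; right; rewrite cards0; split=> //.
  by move=> x; rewrite inE.
have /card_gt0P[x xS] : 0 < #|S| by apply: leq_trans cS; rewrite expn_gt0.
pose N := [set y in S :\ x | e x y]; pose M := [set y in S :\ x | ~~ e x y].
have cNM : #|S| = (#|N| + #|M|).+1.
  rewrite (cardsD1 x) xS; congr (_.+1); rewrite -(cardsID [set y | e x y] (S :\ x)).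
  by congr (_ + _); apply: eq_card => y; rewrite !inE // andbC.
have NS : N \subset S by apply/subsetP=> y; rewrite !inE -andbA => /and3P[].
have MS : M \subset S by apply/subsetP=> y; rewrite !inE -andbA => /and3P[].
have [cN|cN] := leqP (2 ^ m) #|N|.
  have [|A AN hA] := IH a b.+1 _ N cN; first by lia.
  have AS := subset_trans AN NS.
  case: hA => [[cA hA]|hB]; last by exists A => //; right.
  have AP y : y \in A -> (y != x) && e x y.
    by move=> /(subsetP AN); rewrite !inE -andbA => /and3P[-> _ ->].
  exists (x |: A); first by rewrite subUset sub1set xS.
  left; split.
    by rewrite cardsU1 cA; case: (boolP (x \in A)) => // /AP; rewrite eqxx.
  move=> y z /setU1P[->|yA] /setU1P[->|zA] //.
  - by rewrite eqxx.
  - by case/andP: (AP _ zA).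
  - by rewrite esym; case/andP: (AP _ yA).
  - exact: hA.
have cM : 2 ^ m <= #|M| by move: cS; rewrite cNM expnS; lia.
have [|A AM hA] := IH a.+1 b _ M cM; first by lia.
have AS := subset_trans AM MS.
case: hA => [hA|[cA hA]]; first by exists A => //; left.
have AP y : y \in A -> (y != x) && ~~ e x y.
  by move=> /(subsetP AM); rewrite !inE -andbA => /and3P[-> _ ->].
exists (x |: A); first by rewrite subUset sub1set xS.
right; split.
  by rewrite cardsU1 cA; case: (boolP (x \in A)) => // /AP; rewrite eqxx.
move=> y z /setU1P[->|yA] /setU1P[->|zA] //.
- by rewrite eqxx.
- by case/andP: (AP _ zA).
- by rewrite esym; case/andP: (AP _ yA).
- exact: hA.
Qed.

Lemma large_stable (G : sgraph) n b (S : {set G}) :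
  ~ embeds (complete_graph n) G -> 2 ^ (n + b) <= #|S| ->
  exists2 A : {set G}, A \subset S & #|A| = b /\ stable A.
Proof.
move=> KG cS; have [A AS [[cA hA]|[cA hA]]] := ramsey (@adj_sym G) cS.
  by case: KG; rewrite -cA; apply: embeds_clique.
exists A => //; split=> // x y xA yA.
by have [->|ne] := eqVneq x y; [rewrite adj_irr | apply: hA].
Qed.

Lemma embeds_Sstar (G : sgraph) n (x : G) (A : {set G}) (z : G -> G) :
    #|A| = n -> stable A -> {in A, forall y, adj x y} ->
    {in A, forall y, (z y != x) && ~~ adj x (z y)} ->
    {in A &, forall y y', adj y' (z y) = (y' == y)} ->
    {in A &, forall y y', ~~ adj (z y) (z y')} ->
  embeds (Sstar n) G.
Proof.
move=> cA sA xA xz yz zz.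
pose y (i : 'I_n) : G := enum_val (cast_ord (esym cA) i).
have yA i : y i \in A by apply: enum_valP.
have yI i j : (y i == y j) = (i == j) by rewrite (inj_eq enum_val_inj).
pose g (v : label n) := match v with X _ => x | Y i => y i | Z i => z (y i) end.
have xyF i : (x == y i) = false.
  by apply: contraTF (xA _ (yA i)) => /eqP->; rewrite adj_irr.
have yzF i j : (y i == z (y j)) = false.
  apply: contraTF (xA _ (yA i)) => /eqP->.
  by case/andP: (xz _ (yA j)).
have zxF i : (z (y i) == x) = false by case/andP: (xz _ (yA i)) => /negPf.
have zI i j : (z (y i) == z (y j)) = (i == j).
  apply/eqP/eqP => [e|-> //]; apply/eqP; rewrite -yI.
  by rewrite -yz // -e yz.
apply: (@embeds_labels _ _ _ _ g) => [[i|i|i] [j|j|j]|[i|i|i] [j|j|j]];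
  rewrite !inE /g.
- by move=> i0 j0 _; congr X; apply: ord_inj; lia.
- by move=> _ _ /eqP; rewrite xyF.
- by move=> _ _ /esym/eqP; rewrite zxF.
- by move=> _ _ /esym/eqP; rewrite xyF.
- by move=> _ _ /eqP; rewrite yI => /eqP->.
- by move=> _ _ /eqP; rewrite yzF.
- by move=> _ _ /eqP; rewrite zxF.
- by move=> _ _ /esym/eqP; rewrite yzF.
- by move=> _ _ /eqP; rewrite zI => /eqP->.
- by move=> i0 j0; rewrite adj_irr rel_adjE ?labE /=; lia.
- by move=> i0 _; rewrite rel_adjE ?labE /= xA //; lia.
- by move=> i0 _; rewrite rel_adjE ?labE /=; case/andP: (xz _ (yA j)) => _ /negPf.
- by move=> _ j0; rewrite rel_adjE ?labE /= adj_sym xA //; lia.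
- by move=> _ _; rewrite rel_adjE ?labE /= (negPf (sA _ _ _ _)) ?andbF.
- by move=> _ _; rewrite rel_adjE ?labE /= yz // yI orbF.
- by move=> _ j0; rewrite rel_adjE ?labE /= adj_sym; case/andP: (xz _ (yA i)) => _ /negPf.
- by move=> _ _; rewrite rel_adjE ?labE /= adj_sym yz // yI.
- by move=> _ _; rewrite rel_adjE ?labE /= (negPf (zz _ _ _ _)) ?andbF.
Qed.

(** * Domination of balls *)

Definition nbh (G : sgraph) (x : G) : {set G} := [set y | adj x y].

(** Two nested uses of Ramsey: so many vertices without [K_n] contain 2^(n+n) stable ones, and among
    the private neighbours of these there is a clique or a stable set of size n. *)
Definition dom_const n := 2 ^ (n + 2 ^ (n + n)).

Lemma dominate_step (G : sgraph) n (x : G) (B C : {set G}) :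
    ~ embeds (complete_graph n) G -> ~ embeds (Sstar n) G ->
    B \subset nbh x -> {in C, forall v, (v != x) && ~~ adj x v} ->
    {in C, forall v, exists2 b, b \in B & adj b v} ->
  exists D : {set G}, [/\ D \subset B, #|D| <= dom_const n &
    {in C, forall v, exists2 b, b \in D & adj b v}].
Proof.
move=> KG SG Bx Cx CB.
pose dom (D : {set G}) := [forall v in C, [exists b in D, adj b v]].
have domB : dom B.
  by apply/forall_inP => v /CB[b bB bv]; apply/existsP; exists b; rewrite bB.
have [D /minsetP[domD minD] DB] := minset_exists domB.
exists D; split=> //; last first.
  by move=> v vC; have /existsP[b /andP[bD bv]] := forall_inP domD _ vC; exists b.
rewrite leqNgt; apply/negP => cD; apply: SG.
have priv b : b \in D -> exists v, [&& v \in C, adj b v &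
    [forall b' in D, adj b' v ==> (b' == b)]].
  move=> bD; have : ~~ dom (D :\ b).
    apply/negP => /minD/(_ (subsetDl _ _)) e.
    by move: bD; rewrite -e !inE eqxx.
  rewrite negb_forall_in => /exists_inP[v vC]; rewrite negb_exists => /forallP h.
  have own b' : b' \in D -> adj b' v -> b' = b.
    by move=> b'D b'v; have := h b'; rewrite !inE b'D b'v !andbT negbK => /eqP.
  have /existsP[b' /andP[b'D b'v]] := forall_inP domD _ vC.
  exists v; rewrite vC -{1}(own b') // b'v; apply/forall_inP => b2 b2D.
  by apply/implyP => /own->.
(* A private neighbour of each [b] in [D]; the default is never reached inside [D]. *)
pose z b := odflt b [pick v | [&& v \in C, adj b v &
    [forall b' in D, adj b' v ==> (b' == b)]]].
have zP b : b \in D -> [/\ z b \in C, adj b (z b) &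
    {in D, forall b', adj b' (z b) -> b' = b}].
  move=> bD; rewrite /z; case: pickP => [v /and3P[vC bv /forall_inP h]|h].
    by split=> // b' /h /implyP h' /h' /eqP.
  by have [v] := priv b bD; rewrite h.
have [A AD [cA sA]] := large_stable KG (ltnW cD).
have zsym : symmetric (fun b b' => adj (z b) (z b')) by move=> b b'; apply: adj_sym.
have zz b b' : b \in D -> b' \in D -> (z b == z b') = (b == b').
  move=> bD b'D; apply/eqP/eqP => [e|-> //].
  have [_ + _] := zP b bD; rewrite e; have [_ _ h] := zP b' b'D; exact: h.
have cA' : 2 ^ (n + n) <= #|A| by rewrite cA.
(* [A] is stable already; this makes the private neighbours stable too. A clique among them is a
   [K_n], since [z] is injective on [D]. *)
have [A' A'A [[cA2 hA]|[cA2 hA]]] := ramsey zsym cA'.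
  case: KG; rewrite -cA2.
  have A'D b : b \in A' -> b \in D by move/(subsetP A'A)/(subsetP AD).
  rewrite -(@card_in_imset _ _ z (mem A')); last first.
    by move=> b b' /A'D bD /A'D b'D /eqP; rewrite zz // => /eqP.
  apply: embeds_clique => _ _ /imsetP[b bA ->] /imsetP[b' b'A ->].
  by rewrite zz ?A'D // => ne; apply: hA.
have A'D b : b \in A' -> b \in D by move/(subsetP A'A)/(subsetP AD).
apply: (@embeds_Sstar _ _ x A' z) => //.
- by move=> b b' /(subsetP A'A) bA /(subsetP A'A); apply: sA.
- by move=> b /A'D/(subsetP DB)/(subsetP Bx); rewrite inE.
- by move=> b /A'D/zP[/Cx].
- move=> b b' /A'D bD /A'D b'D; have [_ bz h] := zP b bD.
  by apply/idP/eqP => [/h->|->].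
- move=> b b' bA b'A; have [->|ne] := eqVneq b b'; first by rewrite adj_irr.
  exact: hA.
Qed.

Definition ball (G : sgraph) (x : G) (k : nat) : {set G} :=
  iter k (fun S : {set G} => S :|: \bigcup_(y in S) nbh y) [set x].

Lemma ballS (G : sgraph) (x v : G) k :
  reflect (v \in ball x k \/ exists2 u, u \in ball x k & adj u v)
          (v \in ball x k.+1).
Proof.
rewrite /ball iterS inE; apply: (iffP orP) => [[h|/bigcupP[u uB]]|[h|[u uB uv]]].
- by left.
- by rewrite inE; right; exists u.
- by left.
- by right; apply/bigcupP; exists u; rewrite ?inE.
Qed.

Lemma ball_leq (G : sgraph) (x : G) j k : j <= k -> ball x j \subset ball x k.
Proof.
elim: k => [|k IH]; first by case: j.
rewrite leq_eqVlt => /predU1P[-> //|/IH h].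
by apply: subset_trans h _; apply/subsetP => v vB; apply/ballS; left.
Qed.

(** A vertex d of the ball of radius k is neither in level k+2 nor adjacent to it, which is what
    [dominate_step] asks of its centre. So every d passes on at most [dom_const n] dominators to the
    next level, whence the power. *)
Lemma level_dominated (G : sgraph) n (x : G) k :
    ~ embeds (complete_graph n) G -> ~ embeds (Sstar n) G ->
  exists D : {set G}, [/\ D \subset ball x k, #|D| <= dom_const n ^ k &
    {in ball x k.+1 :\: ball x k, forall v, exists2 d, d \in D & adj d v}].
Proof.
move=> KG SG; elim: k => [|k [D [Dk cD hD]]].
  exists [set x]; rewrite cards1; split=> // v /setDP[/ballS[|] //].
  by move=> vx; rewrite vx.
pose C := ball x k.+2 :\: ball x k.+1.
have step d : exists E : {set G}, d \in D ->
    [/\ E \subset nbh d :&: (ball x k.+1 :\: ball x k), #|E| <= dom_const n &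
     {in [set v in C | [exists b, (b \in nbh d :&: (ball x k.+1 :\: ball x k)) && adj b v]],
        forall v, exists2 b, b \in E & adj b v}].
  have [dD|dD] := boolP (d \in D); last by exists set0.
  have [|v||E [h1 h2 h3]] := dominate_step KG SG
     (_ : nbh d :&: (ball x k.+1 :\: ball x k) \subset nbh d)
     (C := [set v in C | [exists b, (b \in nbh d :&: (ball x k.+1 :\: ball x k)) && adj b v]]).
  - exact: subsetIl.
  - move=> /setIdP[/setDP[_ vk] _]; apply/andP; split.
      apply: contraNneq vk => ->.
      by apply: (subsetP (ball_leq x (leqnSn k))); apply: (subsetP Dk).
    by apply: contra vk => dv; apply/ballS; right; exists d => //; apply: (subsetP Dk).
  - by move=> v /setIdP[_ /existsP[b /andP[? ?]]]; exists b.
  - by exists E.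
have [E EP] := choice step.
exists (\bigcup_(d in D) E d); split.
- apply/bigcupsP => d /EP[h _ _]; apply: subset_trans h _.
  by apply/subsetP => v /setIP[_ /setDP[]].
- rewrite expnSr; apply: leq_trans (_ : \sum_(d in D) #|E d| <= _).
    elim/big_rec2: _ => [|d s U dD h]; first by rewrite cards0.
    by apply: leq_trans (leq_card_setU _ _) _; rewrite leq_add2l.
  apply: leq_trans (_ : #|D| * dom_const n <= _); last by rewrite leq_mul2r cD orbT.
  by rewrite -sum_nat_const; apply: leq_sum => d /EP[].
- move=> v vC; have /setDP[/ballS vB nvB] := vC.
  case: vB => [h|[u uB uv]]; first by rewrite h in nvB.
  have uL : u \in ball x k.+1 :\: ball x k.
    rewrite in_setD uB andbT; apply: contra nvB => h; apply/ballS; right; by exists u.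
  have [d dD du] := hD u uL; have [_ _ h] := EP d dD.
  have [|b bE bv] := h v; last by exists b => //; apply/bigcupP; exists d.
  rewrite in_set vC; apply/existsP; exists u; rewrite in_setI uL uv !andbT.
  by rewrite in_set.
Qed.

Definition dominated (G : sgraph) (A D : {set G}) :=
  {in A, forall v, v \in D \/ exists2 d, d \in D & adj d v}.

Fixpoint ball_const n k :=
  if k is j.+1 then ball_const n j + dom_const n ^ j else 1.

Lemma ball_dominated (G : sgraph) n (x : G) k :
    ~ embeds (complete_graph n) G -> ~ embeds (Sstar n) G ->
  exists2 D : {set G}, #|D| <= ball_const n k & dominated (ball x k) D.
Proof.
move=> KG SG; elim: k => [|k [D cD hD]].
  by exists [set x]; rewrite ?cards1 // => v; left.
have [E [_ cE hE]] := level_dominated x k KG SG.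
exists (D :|: E).
  by apply: leq_trans (leq_card_setU _ _) _; apply: leq_add.
move=> v vB; have [vk|vk] := boolP (v \in ball x k).
  case: (hD v vk) => [h|[d dD dv]]; first by left; rewrite inE h.
  by right; exists d; rewrite // inE dD.
have [|d dE dv] := hE v; first by rewrite in_setD vk vB.
by right; exists d; rewrite // inE dE orbT.
Qed.

(** This makes f the graph distance from r, expressed by balls instead of shortest walks. *)
Definition distance (G : sgraph) (r : G) (f : G -> nat) :=
  forall v k, (v \in ball r k) = (f v <= k).

Lemma distance_ex (G : sgraph) (r : G) : connected G -> exists f, distance r f.
Proof.
case=> _ conn.
have ex v : exists k, v \in ball r k.
  have /connectP[p] := conn r v; elim/last_ind: p v => [|p y IH] v /=.
    by move=> _ ->; exists 0; rewrite inE.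
  rewrite rcons_path last_rcons => /andP[pp yl] ->.
  have [k kP] := IH _ pp erefl; exists k.+1; apply/ballS; right; by exists (last r p).
exists (fun v => ex_minn (ex v)) => v k; case: ex_minnP => m mB mmin.
by apply/idP/idP => [/mmin//|/(ball_leq r)/subsetP]; apply.
Qed.

(** * Geodesics and their twins *)

Section InducedPaths.
Variables (G : sgraph) (n : nat).

Definition ipath (p : nat -> G) L := forall i j, i <= L -> j <= L ->
  (p i == p j) = (i == j) /\ adj (p i) (p j) = (i.+1 == j) || (j.+1 == i).

(** Common frame for the graphs F: the leg y is p read backwards from a, the leg z is p read
    forwards from b. For b = a + 1 the legs touch, as in [F2]; for b = a + 2 the vertex between them
    is free to serve as some x. *)
Lemma embeds_legs (F : rel (label n)) k (x : 'I_n -> G) p L a b :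
    ipath p L -> n <= a.+1 -> a < b -> b + n <= L.+1 ->
    (forall i j : 'I_n, i < k -> j < k -> x i = x j -> i = j) ->
    (forall (i : 'I_n) j, i < k -> j <= L -> j <= a \/ b <= j -> x i != p j) ->
    (forall i j, rel_adj F (Y i) (Y j) = (i.+1 == j) || (j.+1 == i)) ->
    (forall i j, rel_adj F (Z i) (Z j) = (i.+1 == j) || (j.+1 == i)) ->
    (forall i j : 'I_n, adj (p (a - i)) (p (b + j)) = rel_adj F (Y i) (Z j)) ->
    (forall i j : 'I_n, i < k -> j < k -> adj (x i) (x j) = rel_adj F (X i) (X j)) ->
    (forall i j : 'I_n, i < k -> adj (x i) (p (a - j)) = rel_adj F (X i) (Y j)) ->
    (forall i j : 'I_n, i < k -> adj (x i) (p (b + j)) = rel_adj F (X i) (Z j)) ->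
  embeds (@induced (graph_of_rel F) (first_x n k)) G.
Proof.
move=> pP na ab bn xI xp FY FZ FYZ FXX FXY FXZ.
pose g v := match v with X i => x i | Y i => p (a - i) | Z i => p (b + i) end.
have aL (i : 'I_n) : a - i <= L by lia.
have bL (i : 'I_n) : b + i <= L by have := ltn_ord i; lia.
have xa (i j : 'I_n) : i < k -> x i <> p (a - j).
  by move=> ik; apply/eqP; apply: xp => //; left; lia.
have xb (i j : 'I_n) : i < k -> x i <> p (b + j).
  by move=> ik; apply/eqP; apply: xp => //; right; lia.
have pI i j : i <= L -> j <= L -> p i = p j -> i = j.
  by move=> iL jL /eqP; rewrite (pP i j iL jL).1 => /eqP.
have pA i j : i <= L -> j <= L -> adj (p i) (p j) = (i.+1 == j) || (j.+1 == i).
  by move=> iL jL; exact: (pP i j iL jL).2.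
apply: (@embeds_labels _ _ _ _ g) => [[i|i|i] [j|j|j]|[i|i|i] [j|j|j]];
  rewrite !inE /g.
- by move=> ik jk /xI->.
- by move=> ik _ /xa[].
- by move=> ik _ /xb[].
- by move=> _ ik /esym/xa[].
- move=> _ _ /pI e; congr Y; apply: ord_inj; have := e (aL _) (aL _).
  by have := ltn_ord i; have := ltn_ord j; lia.
- by move=> _ _ /pI e; have := e (aL _) (bL _); lia.
- by move=> _ ik /esym/xb[].
- by move=> _ _ /pI e; have := e (bL _) (aL _); lia.
- by move=> _ _ /pI e; congr Z; apply: ord_inj; have := e (bL _) (bL _); lia.
- exact: FXX.
- by move=> ik _; apply: FXY.
- by move=> ik _; apply: FXZ.
- by move=> _ ik; rewrite adj_sym rel_adj_sym; apply: FXY.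
- by move=> _ _; rewrite FY pA //; have := ltn_ord i; have := ltn_ord j; lia.
- by move=> _ _; apply: FYZ.
- by move=> _ ik; rewrite adj_sym rel_adj_sym; apply: FXZ.
- by move=> _ _; rewrite adj_sym rel_adj_sym; apply: FYZ.
- by move=> _ _; rewrite FZ pA //; lia.
Qed.


Lemma embeds_F1 p L k u : 0 < n <= k -> k + n <= L -> ipath p L ->
    (forall i, i <= L -> u != p i) ->
    (forall i, i <= L -> adj u (p i) = (i == k)) -> embeds (F1 n) G.
Proof.
move=> nk kn pP up ua.
have pA i j : i <= L -> j <= L -> adj (p i) (p j) = (i.+1 == j) || (j.+1 == i).
  by move=> iL jL; exact: (pP i j iL jL).2.
have pI i j : i <= L -> j <= L -> (p i == p j) = (i == j).
  by move=> iL jL; exact: (pP i j iL jL).1.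
have kL : k <= L by lia.
pose x (i : 'I_n) := if i == 0 :> nat then p k else u.
apply: (@embeds_legs _ _ x p L k.-1 k.+1) => //; try lia; rewrite /x.
- move=> i j i2 j2; case: eqP => i0; case: eqP => j0 // e; try by apply: ord_inj; lia.
  + by have := up k kL; rewrite e eqxx.
  + by have := up k kL; rewrite e eqxx.
- move=> i j i2 jL h; case: ifP => _; last exact: up.
  by rewrite pI //; lia.
- by move=> i j; rewrite rel_adjE ?labE /= /F1_rel /=; lia.
- by move=> i j; rewrite rel_adjE ?labE /= /F1_rel /=; lia.
- by move=> i j; have hi := ltn_ord i; have hj := ltn_ord j;
    rewrite pA ?rel_adjE ?labE /= /F1_rel /=; lia.
- move=> i j i2 j2; rewrite rel_adjE ?labE /= /F1_rel /=.
  case: eqP => i0; case: eqP => j0; rewrite ?adj_irr ?ua //; try lia.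
  by rewrite adj_sym ua; lia.
- move=> i j i2; have hi := ltn_ord i; have hj := ltn_ord j;
    rewrite rel_adjE ?labE /= /F1_rel /=.
  by case: eqP => i0; rewrite ?pA ?ua; lia.
- move=> i j i2; have hi := ltn_ord i; have hj := ltn_ord j;
    rewrite rel_adjE ?labE /= /F1_rel /=.
  by case: eqP => i0; rewrite ?pA ?ua; lia.
Qed.

Lemma embeds_F2 p L k u : n <= k.+1 -> k + n < L.+1 -> ipath p L ->
    (forall i, i <= L -> u != p i) ->
    (forall i, i <= L -> adj u (p i) = (i == k) || (i == k.+1)) -> embeds (F2 n) G.
Proof.
move=> nk kn pP up ua.
have pA i j : i <= L -> j <= L -> adj (p i) (p j) = (i.+1 == j) || (j.+1 == i).
  by move=> iL jL; exact: (pP i j iL jL).2.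
apply: (@embeds_legs _ _ (fun=> u) p L k k.+1) => //; try lia.
- by move=> i j i1 j1 _; apply: ord_inj; lia.
- by move=> i j _ jL _; apply: up.
- by move=> i j; rewrite rel_adjE ?labE /= /F2_rel /=; lia.
- by move=> i j; rewrite rel_adjE ?labE /= /F2_rel /=; lia.
- by move=> i j; have hi := ltn_ord i; have hj := ltn_ord j;
    rewrite pA ?rel_adjE ?labE /= /F2_rel /=; lia.
- by move=> i j i1 j1; rewrite adj_irr rel_adjE ?labE /= /F2_rel /=; lia.
- by move=> i j i1; have hi := ltn_ord i; have hj := ltn_ord j;
    rewrite rel_adjE ?labE /= /F2_rel /= ua; lia.
- by move=> i j i1; have hi := ltn_ord i; have hj := ltn_ord j;
    rewrite rel_adjE ?labE /= /F2_rel /= ua; lia.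
Qed.

(** The conditions skip the index k, so [p k] may itself belong to [A]; it is one of its own
    twins. *)
Lemma embeds_F3 p L k (A : {set G}) : n <= k -> k + n <= L -> ipath p L ->
    #|A| = n -> stable A ->
    (forall u i, u \in A -> i <= L -> i != k -> u != p i) ->
    (forall u i, u \in A -> i <= L -> i != k ->
       adj u (p i) = (i.+1 == k) || (i == k.+1)) ->
  embeds (F3 n) G.
Proof.
move=> nk kn pP cA sA up ua.
have pA i j : i <= L -> j <= L -> adj (p i) (p j) = (i.+1 == j) || (j.+1 == i).
  by move=> iL jL; exact: (pP i j iL jL).2.
pose x (i : 'I_n) : G := enum_val (cast_ord (esym cA) i).
have xA i : x i \in A by apply: enum_valP.
apply: (@embeds_trans _ (@induced (graph_of_rel (@F3_rel n)) (first_x n n))).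
  apply: (@embeds_into _ (graph_of_rel (@F3_rel n)) _ id) => // -[] i; rewrite inE //.
apply: (@embeds_legs _ _ x p L k.-1 k.+1) => //; try lia.
- by move=> i j _ _ /enum_val_inj/cast_ord_inj.
- by move=> i j _ jL h; apply: up => //; have := ltn_ord i; lia.
- by move=> i j; rewrite rel_adjE ?labE /= /F3_rel /=; lia.
- by move=> i j; rewrite rel_adjE ?labE /= /F3_rel /=; lia.
- by move=> i j; have hi := ltn_ord i; have hj := ltn_ord j;
    rewrite pA ?rel_adjE ?labE /= /F3_rel /=; lia.
- move=> i j _ _; rewrite (negPf (sA _ _ _ _)) // rel_adjE ?labE /= /F3_rel /=; lia.
- by move=> i j _; have hi := ltn_ord i; have hj := ltn_ord j;
    rewrite rel_adjE ?labE /= /F3_rel /= ua //; lia.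
- by move=> i j _; have hi := ltn_ord i; have hj := ltn_ord j;
    rewrite rel_adjE ?labE /= /F3_rel /= ua //; lia.
Qed.

(** The two x are [p k] and u, and whether they are adjacent decides between [F5] and [F4]. *)
Lemma embeds_F45 p L k u : 0 < n <= k -> k + n <= L -> ipath p L ->
    (forall i, i <= L -> u != p i) ->
    (forall i, i <= L -> i != k -> adj u (p i) = (i.+1 == k) || (i == k.+1)) ->
  embeds (F4 n) G \/ embeds (F5 n) G.
Proof.
move=> nk kn pP up ua.
have pA i j : i <= L -> j <= L -> adj (p i) (p j) = (i.+1 == j) || (j.+1 == i).
  by move=> iL jL; exact: (pP i j iL jL).2.
have pI i j : i <= L -> j <= L -> (p i == p j) = (i == j).
  by move=> iL jL; exact: (pP i j iL jL).1.
have kL : k <= L by lia.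
pose x (i : 'I_n) := if i == 0 :> nat then p k else u.
have xI (i j : 'I_n) : i < 2 -> j < 2 -> x i = x j -> i = j.
  rewrite /x => i2 j2; case: eqP => i0; case: eqP => j0 // e; try by apply: ord_inj; lia.
  + by have := up k kL; rewrite e eqxx.
  + by have := up k kL; rewrite e eqxx.
have xp (i : 'I_n) j : i < 2 -> j <= L -> j <= k.-1 \/ k.+1 <= j -> x i != p j.
  by rewrite /x => i2 jL h; case: ifP => _; [rewrite pI //; lia | apply: up].
have [uk|uk] := boolP (adj u (p k)).
  right; apply: (@embeds_legs _ _ x p L k.-1 k.+1) => //; try lia.
  - by move=> i j; rewrite rel_adjE ?labE /= /F5_rel /F3_rel /=; lia.
  - by move=> i j; rewrite rel_adjE ?labE /= /F5_rel /F3_rel /=; lia.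
  - by move=> i j; have hi := ltn_ord i; have hj := ltn_ord j;
      rewrite pA ?rel_adjE ?labE /= /F5_rel /F3_rel /=; lia.
  - move=> i j i2 j2; rewrite rel_adjE ?labE /= /F5_rel /F3_rel /= /x.
    case: eqP => i0; case: eqP => j0; rewrite ?adj_irr ?uk; try lia.
    by rewrite adj_sym uk; lia.
  - move=> i j i2; have hi := ltn_ord i; have hj := ltn_ord j;
      rewrite rel_adjE ?labE /= /F5_rel /F3_rel /= /x.
    by case: eqP => i0; rewrite ?pA ?ua; lia.
  - move=> i j i2; have hi := ltn_ord i; have hj := ltn_ord j;
      rewrite rel_adjE ?labE /= /F5_rel /F3_rel /= /x.
    by case: eqP => i0; rewrite ?pA ?ua; lia.
left; apply: (@embeds_legs _ _ x p L k.-1 k.+1) => //; try lia.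
- by move=> i j; rewrite rel_adjE ?labE /= /F3_rel /=; lia.
- by move=> i j; rewrite rel_adjE ?labE /= /F3_rel /=; lia.
- by move=> i j; have hi := ltn_ord i; have hj := ltn_ord j;
    rewrite pA ?rel_adjE ?labE /= /F3_rel /=; lia.
- move=> i j i2 j2; rewrite rel_adjE ?labE /= /F3_rel /= /x.
  case: eqP => i0; case: eqP => j0; rewrite ?adj_irr ?(negPf uk); try lia.
  by rewrite adj_sym (negPf uk); lia.
- move=> i j i2; have hi := ltn_ord i; have hj := ltn_ord j;
    rewrite rel_adjE ?labE /= /F3_rel /= /x.
  by case: eqP => i0; rewrite ?pA ?ua; lia.
- move=> i j i2; have hi := ltn_ord i; have hj := ltn_ord j;
    rewrite rel_adjE ?labE /= /F3_rel /= /x.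
  by case: eqP => i0; rewrite ?pA ?ua; lia.
Qed.

End InducedPaths.

(** * Twins along a geodesic from the root *)

Section Tubes.
Variables (G : sgraph) (r : G) (f : G -> nat).
Hypothesis fE : distance r f.

Lemma dist_adj u v : adj u v -> f v <= (f u).+1.
Proof. by move=> uv; rewrite -fE; apply/ballS; right; exists u => //; rewrite fE. Qed.

Lemma dist_adj2 u v : adj u v -> (f v <= (f u).+1) && (f u <= (f v).+1).
Proof. by move=> uv; rewrite !dist_adj // adj_sym. Qed.

Lemma dist_pred v k : f v = k.+1 -> exists2 u, adj u v & f u = k.
Proof.
move=> fv; have /ballS[|[u uB uv]] : v \in ball r k.+1 by rewrite fE fv.
  by rewrite fE fv ltnn.
by exists u => //; have := dist_adj uv; move: uB; rewrite fE fv; lia.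
Qed.

(** Position and distance agree, so p starts at the root and adjacent vertices differ by at most one
    in position; this is why p is induced. *)
Definition geod (p : nat -> G) L :=
  (forall i, i <= L -> f (p i) = i) /\ (forall i, i < L -> adj (p i) (p i.+1)).

Lemma geod_ex v : exists2 p, geod p (f v) & p (f v) = v.
Proof.
move: {-1}(f v) (erefl (f v)) => k; elim: k v => [|k IH] v fv.
  by exists (fun=> v) => //; split=> // i; rewrite leqn0 => /eqP->.
have [u uv fu] := dist_pred fv; have [p [pf pa] pu] := IH u fu.
exists (fun i => if i <= k then p i else v); last by rewrite ltnn.
split=> i ik; first by case: ifP => [/pf //|]; rewrite fv; lia.
have [->|ne] := eqVneq i k; first by rewrite leqnn ltnn pu.
by rewrite ifT ?ifT; [apply: pa| |]; lia.
Qed.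

Lemma geod_ipath p L : geod p L -> ipath p L.
Proof.
move=> [pf pa] i j iL jL; split.
  by apply/eqP/eqP => [/(congr1 f)|-> //]; rewrite !pf.
apply/idP/idP => [a|/orP[]/eqP e]; last 2 first.
- by rewrite -e pa //; lia.
- by rewrite -e adj_sym pa //; lia.
have := dist_adj2 a; rewrite !pf //; suff : i != j by lia.
by apply: contraTneq a => ->; rewrite adj_irr.
Qed.


Lemma geod_adjE p L j u i : geod p L -> f u = j -> i <= L ->
  ~~ (j.-1 <= i <= j.+1) -> adj u (p i) = false.
Proof.
move=> [pf _] fu iL h; apply: contraNF h => /dist_adj2; rewrite pf // fu; lia.
Qed.

(** Adjacency to [p j] is left open, so twins may be true or false ones, and [p j] is its own
    twin. *)
Definition twin (p : nat -> G) j u :=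
  [&& f u == j, adj u (p j.-1) & adj u (p j.+1)].

Lemma twin_self p L j : geod p L -> 0 < j < L -> twin p j (p j).
Proof.
move=> gp jL; have ip := geod_ipath gp; have [pf pa] := gp.
by rewrite /twin pf ?eqxx ?(ip _ _ _ _).2 /=; lia.
Qed.

(** Rerouting through a twin gives another geodesic, to which every result on geodesics applies;
    this relates twins at neighbouring levels. *)
Definition swap (p : nat -> G) j t i := if i == j then t else p i.

Lemma geod_swap p L j t : geod p L -> 0 < j < L -> twin p j t ->
  geod (swap p j t) L.
Proof.
move=> [pf pa] jL /and3P[/eqP ft t1 t2]; rewrite /swap; split=> i iL.
  by case: eqP => [->//|_]; apply: pf.
have [ij|ij] := eqVneq i j.
  by rewrite ij ifF //; lia.
have [ij'|ij'] := eqVneq i.+1 j; last exact: pa.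
by rewrite adj_sym (_ : i = j.-1) //; lia.
Qed.

Lemma twin_neq p L j i u : geod p L -> 0 < j < L -> twin p j u -> i <= L ->
  i != j -> u != p i /\ adj u (p i) = (i.+1 == j) || (i == j.+1).
Proof.
move=> gp jL /and3P[/eqP fu u1 u2] iL ij; have [pf pa] := gp; split.
  by apply: contra_neq ij => /(congr1 f); rewrite pf // fu.
have [->|h1] := eqVneq i j.+1; first by rewrite orbT.
have [h2|h2] := eqVneq i.+1 j; first by rewrite (_ : i = j.-1) ?u1 //; lia.
by rewrite (geod_adjE gp fu) //; lia.
Qed.

Variable n : nat.
Hypotheses (n0 : 0 < n) (noF1 : ~ embeds (F1 n) G) (noF2 : ~ embeds (F2 n) G).

(* A neighbour of the middle of a geodesic sees one vertex of it (F1), two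
   consecutive ones (F2), or two at distance 2, since it sees at most three
   consecutive levels. *)
Lemma geod_attach p L j u : geod p L -> n < j -> j + n < L -> f u = j ->
  [|| adj u (p j.-1), adj u (p j) | adj u (p j.+1)] ->
  adj u (p j.-1) && adj u (p j.+1).
Proof.
move=> gp nj jn fu; have ip := geod_ipath gp; have [pf pa] := gp.
have [-> _|une] := eqVneq u (p j).
  rewrite (ip _ _ _ _).2 ?(ip _ _ _ _).2; lia.
have up i : i <= L -> u != p i.
  move=> iL; have [-> //|ij] := eqVneq i j.
  by apply: contra_neq ij => /(congr1 f); rewrite fu pf.
have ua i : i <= L -> ~~ (j.-1 <= i <= j.+1) -> adj u (p i) = false.
  exact: geod_adjE.
(* The only neighbour may be at level j - 1 or j + 1, which is why n < j and j + n < L are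
   strict. *)
have case1 k : k = j.-1 \/ k = j \/ k = j.+1 ->
    (forall i, j.-1 <= i <= j.+1 -> adj u (p i) = (i == k)) -> False.
  move=> kj h; apply: noF1; apply: (@embeds_F1 _ _ p L k u) => //; try lia.
  move=> i iL; have [ij|ij] := boolP (j.-1 <= i <= j.+1); first exact: h.
  by rewrite ua //; lia.
have case2 k : k = j.-1 \/ k = j ->
    (forall i, j.-1 <= i <= j.+1 -> adj u (p i) = (i == k) || (i == k.+1)) -> False.
  move=> kj h; apply: noF2; apply: (@embeds_F2 _ _ p L k u) => //; try lia.
  move=> i iL; have [ij|ij] := boolP (j.-1 <= i <= j.+1); first exact: h.
  by rewrite ua //; lia.
have split3 i : j.-1 <= i <= j.+1 -> [\/ i = j.-1, i = j | i = j.+1].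
  move=> h; have [->|h1] := eqVneq i j.-1; first by constructor.
  have [->|h2] := eqVneq i j; first by constructor.
  by apply: Or33; lia.
case a1: (adj u (p j.-1)); case a2: (adj u (p j)); case a3: (adj u (p j.+1)) => //= _.
- case: (case2 j.-1); first by left.
  by move=> i /split3[]->; rewrite ?a1 ?a2 ?a3; lia.
- case: (case1 j.-1); first by left.
  by move=> i /split3[]->; rewrite ?a1 ?a2 ?a3; lia.
- case: (case2 j); first by right.
  by move=> i /split3[]->; rewrite ?a1 ?a2 ?a3; lia.
- case: (case1 j); first by right; left.
  by move=> i /split3[]->; rewrite ?a1 ?a2 ?a3; lia.
- case: (case1 j.+1); first by right; right.
  by move=> i /split3[]->; rewrite ?a1 ?a2 ?a3; lia.
Qed.

(** On the geodesic rerouted through t, u is attached, so it sees the positions f u - 1 and f u + 1.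
    At most one of these is t; the other is on p, so u is attached to p as well. Using level f u
    next to j costs one more unit of margin. *)
Lemma twin_adj p L j t u : geod p L -> n.+1 < j -> j + n.+1 < L ->
  twin p j t -> adj t u -> twin p (f u) u.
Proof.
move=> gp nj jn tt tu; have jL : 0 < j < L by lia.
have gs := geod_swap gp jL tt.
have /andP[fu1 fu2] := dist_adj2 tu.
have ft : f t = j by case/and3P: tt => /eqP.
have nu : n < f u by lia.
have uL : f u + n < L by lia.
have /andP[s1 s2] : adj u (swap p j t (f u).-1) && adj u (swap p j t (f u).+1).
  apply: geod_attach gs nu uL erefl _; rewrite /swap.
  have : [|| (f u).-1 == j, f u == j | (f u).+1 == j] by lia.
  by have ut : adj u t; [rewrite adj_sym | case/or3P => ->; rewrite /= ut ?orbT].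
rewrite /twin eqxx /=; apply: geod_attach gp nu uL erefl _.
move: s1 s2; rewrite /swap; case: eqP => h1; case: eqP => h2; lia.
Qed.

(** Reroute p through t: s sees position j + 2, hence is attached, hence sees position j, which is
    t. *)
Lemma twin_twin p L j t s : geod p L -> n.+1 < j -> j + n.+2 < L ->
  twin p j t -> twin p j.+1 s -> adj t s.
Proof.
move=> gp nj jn tt /and3P[/eqP fs s1 s2].
have gs : geod (swap p j t) L by apply: geod_swap => //; lia.
have : adj s (swap p j t j.+1.-1) && adj s (swap p j t j.+2).
  apply: geod_attach gs _ _ fs _; try lia.
  by rewrite {3}/swap ifF ?s2 ?orbT //; lia.
by rewrite /= {1}/swap eqxx adj_sym => /andP[].
Qed.

(** Iterating [twin_adj]: a geodesic that has once met the twins of p stays among them as long as it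
    is far from the ends of p. [twin_down] is the same in the other direction. *)
Lemma twin_up p L q M i k : geod p L -> geod q M -> n.+1 < i -> i <= k <= M ->
  k + n < L -> twin p i (q i) -> twin p k (q k).
Proof.
move=> gp [qf qa] ni ikM kn ti; move: ikM kn => /andP[ik kM] kn.
suff h d : d <= k - i -> twin p (i + d) (q (i + d)) by rewrite -(subnKC ik) h.
elim: d => [|d IH] dk; first by rewrite addn0.
have e : f (q (i + d.+1)) = i + d.+1 by apply: qf; lia.
rewrite -{1}e; apply: (@twin_adj p L (i + d) (q (i + d)) _ gp); try lia.
by rewrite addnS; apply: qa; lia.
Qed.

Lemma twin_down p L q M i k : geod p L -> geod q M -> n.+1 < k <= i ->  i <= M ->
  i + n.+1 < L -> twin p i (q i) -> twin p k (q k).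
Proof.
move=> gp [qf qa] /andP[nk ki] iM iL ti.
suff h d : d <= i - k -> twin p (i - d) (q (i - d)) by rewrite -(subKn ki) h.
elim: d => [|d IH] dk; first by rewrite subn0.
have e : f (q (i - d.+1)) = i - d.+1 by apply: qf; lia.
rewrite -{1}e; apply: (@twin_adj p L (i - d) (q (i - d)) _ gp); try lia.
by rewrite adj_sym (_ : i - d = (i - d.+1).+1); [apply: qa|]; lia.
Qed.

Lemma card_twins p L j : ~ embeds (complete_graph n) G -> ~ embeds (F3 n) G ->
  geod p L -> n <= j -> j + n <= L -> #|[set u | twin p j u]| < 2 ^ (n + n).
Proof.
move=> KG F3G gp nj jn; rewrite ltnNge; apply/negP => c.
have [A AT [cA sA]] := large_stable KG c.
have At u : u \in A -> twin p j u by move/(subsetP AT); rewrite inE.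
apply: F3G; apply: (@embeds_F3 _ _ p L j A) => //; first exact: geod_ipath.
- move=> u i /At tu iL ij.
  by have [] := @twin_neq p L j i u gp _ tu iL ij; lia.
- move=> u i /At tu iL ij.
  by have [] := @twin_neq p L j i u gp _ tu iL ij; lia.
Qed.

Lemma twin_unique p L j u : ~ embeds (F4 n) G -> ~ embeds (F5 n) G ->
  geod p L -> n <= j -> j + n <= L -> twin p j u -> u = p j.
Proof.
move=> F4G F5G gp nj jn tu; apply/eqP; apply: contraT => une.
have jL : 0 < j < L by lia.
have [] // := @embeds_F45 G n p L j u _ _ (geod_ipath gp) _ _; try lia.
- move=> i iL; have [->//|ij] := eqVneq i j.
  by have [] := twin_neq gp jL tu iL ij.
- by move=> i iL ij; have [] := twin_neq gp jL tu iL ij.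
Qed.

End Tubes.

Lemma leq_card_bigcup (I T : finType) (Q : {set I}) (A : I -> {set T}) c :
  {in Q, forall x, #|A x| <= c} -> #|\bigcup_(x in Q) A x| <= #|Q| * c.
Proof.
move=> h; rewrite -sum_nat_const.
apply: leq_trans (_ : \sum_(x in Q) #|A x| <= _); last exact: leq_sum.
elim/big_rec2: _ => [|x s U xQ IH]; first by rewrite cards0.
by apply: leq_trans (leq_card_setU _ _) _; rewrite leq_add2l.
Qed.

(** The upper margin is the one that [twin_twin] needs. Below, n + 2 is the first level where
    [twin_adj] applies; the vertices that steer geodesics into the tube sit there, so the tube
    begins one level higher. *)
Definition tube (G : sgraph) (f : G -> nat) n (p : nat -> G) L : {set G} :=
  [set v | [&& n + 3 <= f v, f v + (n + 3) <= L & twin f p (f v) v]].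

(** x is attached to p, hence a twin; [g (n + 3)] is a neighbour of x, hence a twin; then g follows
    p. Since f v is at most L, g can leave the tube only within the last levels, close to the end of
    p. *)
Lemma tube_capture (G : sgraph) r f n p L (x v : G) g : distance r f -> 0 < n ->
    ~ embeds (F1 n) G -> ~ embeds (F2 n) G -> geod f p L -> n.*2 + 10 <= L ->
    f x = n + 2 -> adj x (p (n + 3)) -> adj x (g (n + 3)) ->
    geod f g (f v) -> g (f v) = v -> f v <= L -> n.*2 + 10 < f v ->
  v \in tube f n p L \/ v \in ball (p (L - (n + 4))) (n + 4).
Proof.
move=> fE n0 F1G F2G gp Ln fx xp xg gg gv fvL fv; have [gf ga] := gg.
have tx : twin f p (n + 2) x.
  rewrite /twin fx eqxx /=.
  apply: (geod_attach fE n0 F1G F2G gp) => //; try lia.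
  by rewrite -[(n + 2).+1]addnS xp !orbT.
have tg : twin f p (n + 3) (g (n + 3)).
  rewrite -{1}(gf (n + 3)); last by lia.
  by apply: (twin_adj fE n0 F1G F2G gp _ _ tx xg); lia.
have [b|b] := leqP (f v + (n + 3)) L.
  left; rewrite inE b (_ : n + 3 <= f v) /=; last by lia.
  by rewrite -{2}gv; apply: (twin_up fE n0 F1G F2G gp gg _ _ _ tg); lia.
(* k is the last level of the tube. The twin [g k] is adjacent to [p k.-1], and at most n + 3
   further steps lead to v, which gives the radius n + 4. *)
have [k kL] : exists k, L = k + (n + 3) by exists (L - (n + 3)); lia.
have tb : twin f p k (g k).
  by apply: (twin_up fE n0 F1G F2G gp gg _ _ _ tg); lia.
right; rewrite (_ : L - (n + 4) = k.-1); last by lia.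
have near d : k + d <= f v -> g (k + d) \in ball (p k.-1) d.+1.
  elim: d => [|d IH] hd; apply/ballS; right.
    exists (p k.-1); first by rewrite inE.
    by rewrite addn0 adj_sym; case/and3P: tb.
  exists (g (k + d)); first by apply: IH; lia.
  by rewrite (addnS _ d); apply: ga; lia.
have := near (f v - k); rewrite subnKC ?gv => [/(_ (leqnn _))|]; last by lia.
by apply: (subsetP (ball_leq _ _)); lia.
Qed.

(* Each vertex at level n + 3 has a neighbour in a bounded set Q of level n + 2.
   The tube of x in Q follows a longest geodesic through a neighbour of x; every
   geodesic through a neighbour of x stays in that tube. *)
Lemma tube_structure n : 0 < n -> exists c, forall G : sgraph, connected G ->
    ~ embeds (complete_graph n) G -> ~ embeds (Sstar n) G ->
    ~ embeds (F1 n) G -> ~ embeds (F2 n) G ->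
  exists (r : G) (f : G -> nat) (Q D : {set G}) (p : G -> nat -> G) (L : G -> nat),
  [/\ distance r f, #|Q| <= c, #|D| <= c,
      {in Q, forall x, geod f (p x) (L x) /\ n.*2 + 10 <= L x} &
      dominated (~: \bigcup_(x in Q) tube f n (p x) (L x)) D].
Proof.
move=> n0.
(* One ball about the root and one near the end of each tube; the successor makes room for the bound
   on [Q]. *)
exists (ball_const n (n.*2 + 10) + dom_const n ^ (n + 2) * (ball_const n (n + 4)).+1).
move=> G conn KG SG F1G F2G.
have [/card_gt0P[r _] _] := conn; have [f fE] := distance_ex r conn.
have [Q0 [Q0B cQ0 hQ0]] := level_dominated r (n + 2) KG SG.
have [D0 cD0 hD0] := ball_dominated r (n.*2 + 10) KG SG.
(* The vertices reached from the root by a geodesic whose vertex at level n + 3 is a neighbour of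
   x. *)
pose desc x v := n + 3 <= f v /\
  exists g, [/\ geod f g (f v), g (f v) = v & adj x (g (n + 3))].
(* Only x with a deep enough descendant matter: this leaves room for both margins of the tube, and
   shallow vertices lie in the ball dominated by [D0]. *)
pose Q := [set x in Q0 | `[< exists2 v, desc x v & n.*2 + 10 <= f v >]].
have ch x : exists pL : (nat -> G) * nat, x \in Q ->
    [/\ geod f pL.1 pL.2, n.*2 + 10 <= pL.2, adj x (pL.1 (n + 3)) &
        forall v, desc x v -> f v <= pL.2].
  have [xQ|xQ] := boolP (x \in Q); last by exists (fun=> x, 0).
  have /setIdP[_ /asboolP[v dv lv]] := xQ.
  have dv' : `[< desc x v >] by apply/asboolP.
  have [w /asboolP[lw [g [gg gw xg]]] mw] := @arg_maxnP _ v (fun w => `[< desc x w >]) f dv'.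
  exists (g, f w) => _; split=> //=.
    by apply: leq_trans lv _; apply: mw.
  by move=> u du; apply: mw; apply/asboolP.
have [pL pLP] := choice ch; pose p x := (pL x).1; pose L x := (pL x).2.
have cQ : #|Q| <= dom_const n ^ (n + 2).
  by apply: leq_trans cQ0; apply: subset_leq_card; apply/subsetP=> x /setIdP[].
have chD x : exists D : {set G}, #|D| <= ball_const n (n + 4) /\
    dominated (ball (p x (L x - (n + 4))) (n + 4)) D.
  by have [D ? ?] := ball_dominated (p x (L x - (n + 4))) (n + 4) KG SG; exists D.
have [Dx DxP] := choice chD.
have gp x : x \in Q -> geod f (p x) (L x) by case/pLP.
exists r, f, Q, (D0 :|: \bigcup_(x in Q) Dx x), p, L; split=> //.
- by apply: leq_trans cQ _; rewrite mulnS; lia.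
- apply: leq_trans (leq_card_setU _ _) _; apply: leq_add => //.
  apply: leq_trans (leq_card_bigcup (c := ball_const n (n + 4)) _) _.
    by move=> x _; case: (DxP x).
  by apply: leq_mul.
- by move=> x xQ; split; [apply: gp | case: (pLP x xQ)].
clear cQ0 cD0 cQ chD ch; move=> v; rewrite inE => vT.
have [fv|fv] := leqP (f v) (n.*2 + 10).
  have [|h|[d dD dv]] := hD0 v; first by rewrite fE.
    by left; rewrite inE h.
  by right; exists d; rewrite // inE dD.
have [g gg gv] := geod_ex fE v; have [gf ga] := gg.
have [|x xQ0 xg] := hQ0 (g (n + 3)).
  by rewrite in_setD -[(n + 2).+1]addnS !fE gf; lia.
have dv : desc x v by split; [lia | exists g].
have xQ : x \in Q.
  by rewrite inE xQ0; apply/asboolP; exists v => //; apply: ltnW.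
have [gpx Lx xp mx] := pLP x xQ; rewrite -/(p x) -/(L x) in gpx Lx xp mx.
have fvL := mx v dv; have [pf pa] := gpx.
have fx : f x = n + 2.
  have := subsetP Q0B x xQ0; rewrite fE => h.
  by have := dist_adj fE xg; rewrite gf; lia.
have [vt|vB] := tube_capture fE n0 F1G F2G gpx Lx fx xp xg gg gv fvL fv.
  by case/negP: vT; apply/bigcupP; exists x.
have [_ hD] := DxP x; case: (hD v vB) => [h|[d dD dv']].
  by left; rewrite inE; apply/orP; right; apply/bigcupP; exists x.
by right; exists d => //; rewrite inE; apply/orP; right; apply/bigcupP; exists x.
Qed.

(** * Covers by stars and paths *)

Definition sp (G : sgraph) (S : {set G}) :=
  is_star (induced S) \/ is_path (induced S).

Lemma is_path_ipath (G : sgraph) (q : nat -> G) L :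
  ipath q L -> is_path (induced [set q (val i) | i : 'I_L.+1]).
Proof.
move=> qP; exists L.+1 => //; pose g (i : path_graph L.+1) : G := q (val (i : 'I_L.+1)).
have e : [set q (val i) | i : 'I_L.+1] = g @: setT.
  by apply/setP => v; apply/imsetP/imsetP => -[i _ ->]; exists i.
have iL (i : 'I_L.+1) : i <= L by have := ltn_ord i; rewrite ltnS.
rewrite e; apply: iso_image => [i j /eqP|i j].
  by rewrite (qP _ _ (iL i) (iL j)).1 => /eqP/val_inj.
by rewrite /g (qP _ _ (iL i) (iL j)).2 /= rel_adjE /= -val_eqE /=; lia.
Qed.

Lemma sp_star (G : sgraph) (d : G) (A : {set G}) :
  A \subset nbh d -> stable A -> sp (d |: A).
Proof.
(* A star needs at least one leaf, so a lone d counts as a path on one vertex. *)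
move=> Ad sA; have [->|A0] := eqVneq A set0.
  by right; rewrite setU0; apply: induced1_is_path.
left; exists #|A|; first by rewrite card_gt0.
pose g (i : star_graph #|A|) : G := if i is Some j then enum_val (j : 'I_#|A|) else d.
have dg (j : 'I_#|A|) : adj d (enum_val j).
  by have := subsetP Ad _ (enum_valP j); rewrite inE.
have -> : d |: A = g @: setT.
  apply/setP => v; apply/setU1P/imsetP => [[->|vA]|[[j|] _ ->]].
  - by exists None.
  - by exists (Some (enum_rank_in vA v)); rewrite //= enum_rankK_in.
  - by right; apply: enum_valP.
  - by left.
apply: iso_image => [[i|] [j|] //= |[i|] [j|]].
- by move/enum_val_inj->.
- by move=> e; have := dg i; rewrite e adj_irr.
- by move=> e; have := dg j; rewrite -e adj_irr.
- by rewrite /= (negPf (sA _ _ _ _)) ?enum_valP // rel_adjE andbF.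
- by rewrite /= adj_sym dg.
- by rewrite /= dg.
- by rewrite /= adj_irr.
Qed.

Section Additive.
Variables (G : sgraph) (Phi : {set G} -> nat -> Prop).
Hypothesis Phi0 : Phi set0 0.
Hypothesis PhiU : forall A B a b, Phi A a -> Phi B b -> Phi (A :|: B) (a + b).

Lemma bigcup_additive (I : finType) (Q : {set I}) (A : I -> {set G}) c :
  {in Q, forall x, Phi (A x) c} -> Phi (\bigcup_(x in Q) A x) (#|Q| * c).
Proof.
move=> h; rewrite -sum_nat_const; elim/big_rec2: _ => // x s U xQ IH.
by apply: PhiU => //; apply: h.
Qed.

End Additive.

Section Covers.
Variable G : sgraph.
Implicit Types A B : {set G}.

(** The pieces may leave [A], which makes the notion pass to subsets; [partable] below cannot afford
    this. *)
Definition coverable A c := exists P : {set {set G}},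
  [/\ {in P, forall S, sp S}, A \subset cover P & #|P| <= c].

Lemma coverable0 : coverable set0 0.
Proof. by exists set0; split; rewrite ?sub0set ?cards0 // => S; rewrite inE. Qed.

Lemma coverable_sub A B a b : B \subset A -> a <= b -> coverable A a -> coverable B b.
Proof.
move=> BA ab [P [h1 h2 h3]]; exists P; split=> //; first exact: subset_trans BA h2.
exact: leq_trans h3 ab.
Qed.

Lemma coverableU A B a b : coverable A a -> coverable B b -> coverable (A :|: B) (a + b).
Proof.
move=> [P [h1 h2 h3]] [Q [k1 k2 k3]]; exists (P :|: Q); split.
- by move=> S /setUP[/h1|/k1].
- by rewrite /cover bigcup_setU; apply: setUSS.
- by apply: leq_trans (leq_card_setU _ _) _; apply: leq_add.
Qed.

Definition coverable_bigcup := bigcup_additive coverable0 coverableU.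

Lemma coverable_sp A : sp A -> coverable A 1.
Proof.
move=> spA; exists [set A]; split; rewrite ?cards1 //; first by move=> S /set1P->.
by rewrite /cover big_set1.
Qed.

Definition colorable A c := exists col : G -> nat,
  {in A, forall v, col v < c} /\ {in A &, forall u v, adj u v -> col u != col v}.

Lemma colorable0 : colorable set0 0.
Proof. by exists (fun=> 0); split=> u; rewrite inE. Qed.

Lemma colorable_sub A B a b : B \subset A -> a <= b -> colorable A a -> colorable B b.
Proof.
move=> /subsetP BA ab [col [h1 h2]]; exists col; split=> [v /BA/h1 h|u v /BA uA /BA vA].
  exact: leq_trans h ab.
exact: h2.
Qed.

Lemma colorableU A B a b : colorable A a -> colorable B b -> colorable (A :|: B) (a + b).
Proof.
move=> [col [h1 h2]] [col' [k1 k2]].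
exists (fun v => if v \in A then col v else a + col' v); split=> [v|u v]; rewrite !inE.
  by case: ifP => [/h1|_ /= /k1]; lia.
case: ifP => uA; case: ifP => vA /=.
- by move=> _ _; apply: h2.
- by move=> _ _ _; have := h1 u uA; lia.
- by move=> _ _ _; have := h1 v vA; lia.
- by move=> uB vB /(k2 _ _ uB vB); rewrite eqn_add2l.
Qed.

Definition colorable_bigcup := bigcup_additive colorable0 colorableU.

Lemma colorable_iso A (H : sgraph) (col : H -> nat) c :
  iso (induced A) H -> (forall x, col x < c) ->
  (forall x y, adj x y -> col x != col y) -> colorable A c.
Proof.
move=> [g [_ gA]] h1 h2.
exists (fun v => if insub v is Some w then col (g (w : induced A)) else 0).
split=> [v vA|u v uA vA uv];
  rewrite ?(insubT (fun x => x \in A) uA) ?(insubT (fun x => x \in A) vA) //.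
by apply: h2; rewrite gA.
Qed.

Lemma sp_colorable A : sp A -> colorable A 2.
Proof.
case=> -[m _ h].
  apply: (colorable_iso (col := fun x : star_graph m => (x == None :> option 'I_m) : nat) h).
    by move=> x; case: eqP.
  by move=> [x|] [y|]; rewrite /= rel_adjE /= ?andbF // eqxx.
apply: (colorable_iso (col := fun x : path_graph m => odd (val (x : 'I_m)) : nat) h).
  by move=> x; case: odd.
move=> x y; rewrite /= rel_adjE /= => /andP[_ /orP[]/eqP<- /=]; by case: odd.
Qed.

Lemma coverable_colorable A c : coverable A c -> colorable A (c * 2).
Proof.
case=> P [h1 h2 h3]; apply: (@colorable_sub (cover P) _ (#|P| * 2)) => //.
  by rewrite leq_mul2r h3.
by apply: colorable_bigcup => S /h1/sp_colorable.
Qed.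

Lemma colorable_set1 x : colorable [set x] 1.
Proof.
exists (fun=> 0); split=> // u v /set1P-> /set1P->; by rewrite adj_irr.
Qed.

Lemma coverable_set1 x : coverable [set x] 1.
Proof. by apply: coverable_sp; right; apply: induced1_is_path. Qed.

(** Each colour class of the neighbourhood is stable and forms a star with d; these stars all share
    d. *)
Lemma coverable_nbh d c : colorable (nbh d) c -> coverable (nbh d) c.
Proof.
case=> col [h1 h2]; pose S (i : 'I_c) := d |: [set v in nbh d | col v == i].
exists [set S i | i : 'I_c]; split.
- move=> _ /imsetP[i _ ->]; apply: sp_star; first by apply/subsetP=> v /setIdP[].
  move=> u v /setIdP[ud /eqP cu] /setIdP[vd /eqP cv].
  by apply/negP => /(h2 u v ud vd); rewrite cu cv eqxx.
- apply/subsetP => v vd; apply/bigcupP; exists (S (Ordinal (h1 v vd))).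
    by apply: imset_f.
  by rewrite in_setU1 in_set vd eqxx orbT.
- by apply: leq_trans (leq_imset_card _ _) _; rewrite card_ord.
Qed.

Lemma setT_dominated_bigcup (D M : {set G}) : dominated (~: M) D ->
  [set: G] = (\bigcup_(d in D) [set d]) :|: (\bigcup_(d in D) nbh d) :|: M.
Proof.
move=> h; apply/setP => v; rewrite !inE; apply/esym.
have [|vM] := boolP (v \in M); first by rewrite orbT.
have [|vD|[d dD dv]] := h v; first by rewrite inE.
  by apply/orP; left; apply/orP; left; apply/bigcupP; exists v; rewrite ?set11.
by apply/orP; left; apply/orP; right; apply/bigcupP; exists d; rewrite ?inE.
Qed.

End Covers.

(** Twins at consecutive levels are always adjacent, and levels further apart are never joined. So
    any choice of one twin per level is an induced path, and as many paths as the largest number of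
    twins suffice. *)
Lemma coverable_tube (G : sgraph) r f n p L : distance r f -> 0 < n ->
    ~ embeds (complete_graph n) G -> ~ embeds (F1 n) G ->
    ~ embeds (F2 n) G -> ~ embeds (F3 n) G ->
    geod f p L -> n.*2 + 10 <= L ->
  coverable (@tube G f n p L) (2 ^ (n + n)).
Proof.
move=> fE n0 KG F1G F2G F3G gp Ln; have [pf pa] := gp.
pose T j := [set u | twin f p j u].
(* The s-th path takes the s-th twin at each level, or the vertex of p where there are fewer
   twins. *)
pose q s i := nth (p (n + 3 + i)) (enum (T (n + 3 + i))) s.
pose M := L - (n + 3) - (n + 3).
have qT s i : i <= M -> twin f p (n + 3 + i) (q s i).
  move=> iM; suff : q s i \in T (n + 3 + i) by rewrite inE.
  rewrite /q; have [h|h] := ltnP s (size (enum (T (n + 3 + i)))).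
    by rewrite -mem_enum mem_nth.
  by rewrite nth_default // inE; apply: (twin_self fE gp); lia.
have qf s i : i <= M -> f (q s i) = n + 3 + i by move/(qT s)/and3P => [/eqP].
have qP s : ipath (q s) M.
  have gq i : i < M -> adj (q s i) (q s i.+1).
    move=> iM; apply: (@twin_twin _ _ _ fE _ n0 F1G F2G p L (n + 3 + i)) => //; try lia.
      by apply: qT; lia.
    by rewrite -addnS; apply: qT.
  move=> i j iM jM; split.
    by apply/eqP/eqP => [/(congr1 f)|-> //]; rewrite !qf //; lia.
  apply/idP/idP => [a|/orP[]/eqP e]; last 2 first.
  - by rewrite -e gq //; lia.
  - by rewrite -e adj_sym gq //; lia.
  have := dist_adj2 fE a; rewrite !qf //; suff : i != j by lia.
  by apply: contraTneq a => ->; rewrite adj_irr.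
exists [set [set q s (val i) | i : 'I_M.+1] | s : 'I_(2 ^ (n + n))]; split.
- by move=> _ /imsetP[s _ ->]; right; apply: is_path_ipath.
- apply/subsetP => v; rewrite inE => /and3P[v1 v2 vt].
  pose i := f v - (n + 3); have fv : n + 3 + i = f v by rewrite /i; lia.
  have vT : v \in enum (T (f v)) by rewrite mem_enum inE.
  have sR : index v (enum (T (f v))) < 2 ^ (n + n).
    apply: ltn_trans (_ : #|T (f v)| < _); first by rewrite cardE index_mem.
    by apply: (card_twins fE n0 KG F3G gp); lia.
  have iM : i < M.+1 by rewrite /i /M; lia.
  apply/bigcupP; exists [set q (Ordinal sR) (val i) | i : 'I_M.+1]; first exact: imset_f.
  apply/imsetP; exists (Ordinal iM) => //=; rewrite /q fv.
  by rewrite nth_index.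
- by apply: leq_trans (leq_imset_card _ _) _; rewrite card_ord.
Qed.

Lemma cover_structure n : 0 < n -> exists c, forall G : sgraph, connected G ->
    ~ embeds (complete_graph n) G -> ~ embeds (Sstar n) G ->
    ~ embeds (F1 n) G -> ~ embeds (F2 n) G -> ~ embeds (F3 n) G ->
  exists D M : {set G}, [/\ #|D| <= c, dominated (~: M) D & coverable M c].
Proof.
move=> n0; have [c cP] := tube_structure n0;
  exists (c * 2 ^ (n + n)) => G conn KG SG F1G F2G F3G.
have [r [f [Q [D [p [L [fE cQ cD QP hD]]]]]]] := cP G conn KG SG F1G F2G.
exists D, (\bigcup_(x in Q) tube f n (p x) (L x)); split=> //.
  by apply: leq_trans cD _; rewrite leq_pmulr // expn_gt0.
apply: (@coverable_sub _ _ _ (#|Q| * 2 ^ (n + n))) (subxx _) _ _.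
  by rewrite leq_mul2r cQ orbT.
apply: coverable_bigcup => x /QP[gp Ln]; exact: (coverable_tube fE).
Qed.

Lemma embeds_complete_cone (G : sgraph) (d : G) (A C : {set G}) k :
  A \subset nbh d -> d |: A \subset C -> embeds (complete_graph k) (induced A) ->
  embeds (complete_graph k.+1) (induced C).
Proof.
move=> /subsetP Ad /subsetP AC [h [hI hA]].
have dh j : adj d (val (h j)) by have := Ad _ (valP (h j)); rewrite inE.
apply: (@embeds_into (complete_graph k.+1) G C (fun i : 'I_k.+1 =>
          if unlift ord0 i is Some j then val (h j) else d)) => [i i'|i i'|i]; last by
  apply: AC; case: unlift => [j|]; rewrite in_setU1 ?eqxx // (valP (h j)) orbT.
  case: unliftP => [j|] ->; case: unliftP => [j'|] -> //.
  - by move/val_inj/hI->.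
  - by move=> e; have := dh j; rewrite e adj_irr.
  - by move=> e; have := dh j'; rewrite -e adj_irr.
rewrite /= rel_adjE /= andbT; case: unliftP => [j|] ->; case: unliftP => [j'|] ->.
- have := hA j j'; rewrite /= rel_adjE /= andbT => e; rewrite [LHS]e.
  by congr (~~ _); apply/esym; exact: (inj_eq (@lift_inj _ ord0)).
- by rewrite adj_sym dh.
- by rewrite dh.
- by rewrite adj_irr eqxx.
Qed.

Lemma embeds_complete0 G : embeds (complete_graph 0) G.
Proof.
by exists (fun i : 'I_0 => match i with Ordinal _ i0 => False_rect G (notF i0) end);
  split=> -[].
Qed.

Lemma colorable_induced (G : sgraph) (A : {set G}) c :
  colorable [set: induced A] c -> colorable A c.
Proof.
case=> col [h1 h2]; apply: (@colorable_iso G A (induced A) col c).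
- by exists id; split=> //; exists id.
- by move=> x; apply: h1.
- by move=> x y; apply: h2.
Qed.

(** * Bounded chromatic number and bounded covers *)

Section Cover.
Variable n : nat.
Hypothesis n0 : 0 < n.

Definition cover_class (G : sgraph) :=
  [/\ ~ embeds (complete_graph n) G, ~ embeds (Sstar n) G, ~ embeds (F1 n) G,
      ~ embeds (F2 n) G & ~ embeds (F3 n) G].

Lemma cover_class_embeds H G : embeds H G -> cover_class G -> cover_class H.
Proof.
by move=> HG [h1 h2 h3 h4 h5]; split=> e;
  [apply: h1|apply: h2|apply: h3|apply: h4|apply: h5]; apply: embeds_trans e HG.
Qed.

(* Induction on the clique number: the neighbourhood of a dominating vertex has
   a smaller one. *)
Lemma chromatic_bound k : exists c, forall G : sgraph,
  ~ embeds (complete_graph k) G -> cover_class G -> colorable [set: G] c.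
Proof.
elim: k => [|k [c0 IHk]]; first by exists 0 => G /(_ (embeds_complete0 G)).
(* One colour for each dominator, c0 for its neighbourhood, two for each star or path of the
   remaining set. The n of [cover_class] stays fixed while k decreases. *)
have [c1 c1P] := cover_structure n0; exists (c1 * 1 + c1 * c0 + c1 * 2) => G.
(* An inner induction on the order: the structure is known for connected graphs only, and
   neighbourhoods need not be connected. Components can reuse the same colours. *)
move: {2}#|G|.+1 (ltnSn #|G|) => m; elim: m G => // m IHm G cG KG clG.
have [G0|Gpos] := posnP #|G|.
  have -> : [set: G] = set0 by apply/setP => v; have := card0_eq G0 v.
  exact: colorable_sub (colorable0 G).
have [conn|nconn] := pselect (connected G).
  have [KnG SG F1G F2G F3G] := clG.
  have [D [M [cD hD cM]]] := c1P G conn KnG SG F1G F2G F3G.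
  rewrite (setT_dominated_bigcup hD).
  apply: colorableU; last exact: coverable_colorable.
  apply: colorableU.
    apply: (@colorable_sub _ _ _ (#|D| * 1)) (subxx _) _ _; first by rewrite leq_mul2r cD.
    by apply: colorable_bigcup => d _; apply: colorable_set1.
  apply: (@colorable_sub _ _ _ (#|D| * c0)) (subxx _) _ _;
    first by rewrite leq_mul2r cD orbT.
  apply: colorable_bigcup => d _; apply: colorable_induced; apply: IHk.
    move/(embeds_complete_cone (subxx _) (subsetT _)) => e; apply: KG.
    exact: embeds_trans e (embeds_induced _).
  by apply: cover_class_embeds clG; apply: embeds_induced.
have [x [y nxy]] : exists x y : G, ~~ connect (@adj G) x y.
  apply: contrapT => h; apply: nconn; split=> // x y.
  by apply: contrapT => nxy; apply: h; exists x, y; apply/negP.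
pose A := [set v | connect (@adj G) x v].
have part (B : {set G}) : (exists v, v \notin B) -> colorable B (c1 * 1 + c1 * c0 + c1 * 2).
  case=> v vB; apply: colorable_induced; apply: IHm.
  - rewrite card_sig; apply: leq_trans (_ : #|B| < #|G|) _; last by rewrite -ltnS.
    rewrite -cardsT; apply: proper_card; rewrite properT.
    by apply: contraNneq vB => ->; rewrite inE.
  - by move/embeds_trans/(_ (embeds_induced B)).
  - by apply: cover_class_embeds clG; apply: embeds_induced.
have [|col [h1 h2]] := part A; first by exists y; rewrite inE.
have [|col' [k1 k2]] := part (~: A); first by exists x; rewrite !inE connect0.
exists (fun v => if v \in A then col v else col' v); split=> [v _|u v _ _ uv].
  by case: ifP => [/h1 //|vA]; apply: k1; rewrite inE vA.
have vA : (v \in A) = (u \in A).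
  rewrite !inE; apply/idP/idP => h; apply: connect_trans h (connect1 _) => //.
  by rewrite adj_sym.
rewrite vA; case: ifP => uA.
- by apply: h2 => //; rewrite vA uA.
- by apply: k2 => //; rewrite inE ?vA uA.
Qed.

Lemma cover_bound : exists c, forall G : sgraph, connected G -> cover_class G ->
  coverable [set: G] c.
Proof.
have [c1 c1P] := cover_structure n0; have [c0 c0P] := chromatic_bound n.
exists (c1 * 1 + c1 * c0 + c1) => G conn clG.
have [KnG SG F1G F2G F3G] := clG.
have [D [M [cD hD cM]]] := c1P G conn KnG SG F1G F2G F3G.
rewrite (setT_dominated_bigcup hD); apply: coverableU cM; apply: coverableU.
  apply: (@coverable_sub _ _ _ (#|D| * 1)) (subxx _) _ _; first by rewrite leq_mul2r cD.
  by apply: coverable_bigcup => d _; apply: coverable_set1.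
apply: (@coverable_sub _ _ _ (#|D| * c0)) (subxx _) _ _; first by rewrite leq_mul2r cD orbT.
apply: coverable_bigcup => d _; apply: coverable_nbh.
exact: colorable_sub (subsetT _) (leqnn _) (c0P G KnG clG).
Qed.

End Cover.

(** * Partitions into stars and paths *)

Section Partitions.
Variable G : sgraph.
Implicit Types A B U : {set G}.

Definition partable A c := exists P : {set {set G}},
  [/\ {in P, forall S, sp S}, cover P = A, trivIset P & #|P| <= c].

Lemma partable_leq A a b : a <= b -> partable A a -> partable A b.
Proof.
by move=> ab [P [h1 h2 h3 h4]]; exists P; split=> //; apply: leq_trans h4 ab.
Qed.

Lemma partable0 : partable set0 0.
Proof.
exists set0; rewrite cards0 /cover big_set0; split=> // [S|]; first by rewrite inE.
by apply/trivIsetP => S S'; rewrite inE.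
Qed.

Lemma partableU A B a b : [disjoint A & B] -> partable A a -> partable B b ->
  partable (A :|: B) (a + b).
Proof.
move=> dAB [P [h1 h2 h3 h4]] [Q [k1 k2 k3 k4]]; exists (P :|: Q); split.
- by move=> S /setUP[/h1|/k1].
- by rewrite /cover bigcup_setU -/(cover P) -/(cover Q) h2 k2.
- by apply: trivIsetU => //; rewrite h2 k2.
- by apply: leq_trans (leq_card_setU _ _) _; apply: leq_add.
Qed.

Lemma partable_sp A : sp A -> partable A 1.
Proof.
move=> spA; exists [set A]; split; rewrite ?cards1 //; first by move=> S /set1P->.
  by rewrite /cover big_set1.
by apply/trivIsetP => S S' /set1P-> /set1P->; rewrite eqxx.
Qed.

(** Each u in turn takes all its neighbours that are left in B. Which ones are left depends on the
    earlier turns, so the hypothesis has to cover every subset of the neighbourhood. *)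
Lemma partable_assign U B c : [disjoint U & B] ->
    {in B, forall v, exists2 u, u \in U & adj u v} ->
    (forall u A, u \in U -> A \subset B -> A \subset nbh u -> partable (u |: A) c) ->
  partable (U :|: B) (#|U| * c).
Proof.
move: {2}#|U| (erefl #|U|) => m; elim: m U B => [|m IH] U B cU dUB hB hp.
  have U0 : U = set0 by apply/eqP; rewrite -cards_eq0 cU.
  have -> : B = set0.
    by apply/setP => v; rewrite inE; apply/negP => /hB[u]; rewrite U0 inE.
  by rewrite U0 setU0 cards0; apply: partable0.
have /card_gt0P[u uU] : 0 < #|U| by rewrite cU.
have UB v : v \in U -> v \in B -> False by move=> vU; rewrite (disjointFr dUB vU).
have -> : U :|: B = (u |: (B :&: nbh u)) :|: ((U :\ u) :|: (B :\: nbh u)).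
  apply/setP => v; rewrite !inE; case: (eqVneq v u) => [->|_] /=; first by rewrite uU.
  by case: (v \in U); case: (v \in B); case: adj.
rewrite (cardsD1 u) uU mulnDl mul1n; apply: partableU.
- rewrite -setI_eq0; apply/eqP/setP => v; rewrite !inE.
  apply/negP => /andP[/orP[/eqP->|/andP[vB vu]]] /orP[/andP[h1 h2]|/andP[h1 h2]].
  + by rewrite eqxx in h1.
  + exact: UB uU h2.
  + exact: UB h2 vB.
  + by rewrite vu in h1.
- by apply: hp => //; [apply: subsetIl | apply: subsetIr].
- apply: IH.
  + by move: cU; rewrite (cardsD1 u) uU => -[].
  + by apply: disjointWl (subsetDl _ _) _; apply: disjointWr (subsetDl _ _) _.
  + move=> v /setDP[vB vu]; have [w wU wv] := hB v vB; exists w => //.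
    by rewrite !inE wU andbT; apply: contraNneq vu => <-; rewrite inE.
  + move=> w A /setD1P[_ wU] AB Aw; apply: hp => //.
    exact: subset_trans AB (subsetDl _ _).
Qed.

(** An induced matching of m edges inside [A], listed by functions of which only the indices below m
    count. *)
Definition imatch A m (y z : nat -> G) :=
  (forall i, i < m -> [/\ y i \in A, z i \in A & adj (y i) (z i)]) /\
  (forall i j, i < m -> j < m -> i != j ->
     [/\ ~~ adj (y i) (y j), ~~ adj (y i) (z j) & ~~ adj (z i) (z j)]).

Lemma embeds_Stilde n d A y z :
  A \subset nbh d -> imatch A n y z -> embeds (Stilde n) G.
Proof.
move=> /subsetP Ad [h1 h2].
have dA v : v \in A -> adj d v by move/Ad; rewrite inE.
have yA (i : 'I_n) : y i \in A by have [] := h1 i (ltn_ord i).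
have zA (i : 'I_n) : z i \in A by have [] := h1 i (ltn_ord i).
have yz (i : 'I_n) : adj (y i) (z i) by have [] := h1 i (ltn_ord i).
have dN v : v \in A -> d <> v by move=> /dA dv e; rewrite e adj_irr in dv.
have yy (i j : 'I_n) : adj (y i) (y j) = false.
  have [->|ij] := eqVneq i j; first exact: adj_irr.
  by have [/negPf] := h2 i j (ltn_ord i) (ltn_ord j) ij.
have zz (i j : 'I_n) : adj (z i) (z j) = false.
  have [->|ij] := eqVneq i j; first exact: adj_irr.
  by have [_ _ /negPf] := h2 i j (ltn_ord i) (ltn_ord j) ij.
have yzE (i j : 'I_n) : adj (y i) (z j) = (i == j).
  have [->|ij] := eqVneq i j; first exact: yz.
  by have [_ /negPf] := h2 i j (ltn_ord i) (ltn_ord j) ij.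
pose g (v : label n) := match v with X _ => d | Y i => y i | Z i => z i end.
apply: (@embeds_labels _ _ _ _ g) => [[i|i|i] [j|j|j]|[i|i|i] [j|j|j]];
  rewrite !inE /g.
- by move=> i0 j0 _; congr X; apply: ord_inj; lia.
- by move=> _ _ /dN[].
- by move=> _ _ /dN[].
- by move=> _ _ /esym/dN[].
- by move=> _ _ e; have := yz i; rewrite e yzE => /eqP->.
- by move=> _ _ e; have := yz i; rewrite e zz.
- by move=> _ _ /esym/dN[].
- by move=> _ _ e; have := yz j; rewrite -e zz.
- by move=> _ _ e; have := yz i; rewrite e yzE => /eqP->.
- by move=> i0 j0; rewrite adj_irr rel_adjE ?labE /Stilde_rel /=; lia.
- by move=> i0 _; rewrite rel_adjE ?labE /Stilde_rel /= dA //; lia.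
- by move=> i0 _; rewrite rel_adjE ?labE /Stilde_rel /= dA //; lia.
- by move=> _ j0; rewrite rel_adjE ?labE /Stilde_rel /= adj_sym dA //; lia.
- by move=> _ _; rewrite yy rel_adjE ?labE /Stilde_rel /= andbF.
- by move=> _ _; rewrite yzE rel_adjE ?labE /Stilde_rel /= !orbF.
- by move=> _ j0; rewrite rel_adjE ?labE /Stilde_rel /= adj_sym dA //; lia.
- by move=> _ _; rewrite adj_sym yzE rel_adjE ?labE /Stilde_rel /= !orbF.
- by move=> _ _; rewrite zz rel_adjE ?labE /Stilde_rel /= andbF.
Qed.

Lemma max_index (P : nat -> Prop) n : P 0 -> ~ P n -> exists2 m, m < n & P m /\ ~ P m.+1.
Proof.
move=> P0; elim: n => // n IH Pn; have [Pn'|/IH[m mn h]] := pselect (P n).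
  by exists n.
by exists m => //; apply: ltnW.
Qed.

End Partitions.

(* A maximal induced matching U in A has fewer than n edges, and the vertices of
   A with no neighbour in U form a stable set, which makes a star with d. *)
Lemma star_partition n k : exists c, forall (G : sgraph) (d : G) (A : {set G}),
    A \subset nbh d -> ~ embeds (Stilde n) G ->
    ~ embeds (complete_graph k) (induced A) -> partable (d |: A) c.
Proof.
elim: k => [|k [c IH]]; first by exists 0 => G d A _ _ /(_ (embeds_complete0 _)).
exists (1 + (n + n) * c) => G d A Ad StG KA.
have dA : d \notin A by apply/negP => /(subsetP Ad); rewrite inE adj_irr.
have [||m mn [[y [z yz]] mmax]] := @max_index (fun m => exists y z, imatch A m y z) n.
- by exists (fun=> d), (fun=> d).
- by move=> [y [z h]]; apply: StG; apply: embeds_Stilde Ad h.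
have [yz1 yz2] := yz.
pose U := [set y (val i) | i : 'I_m] :|: [set z (val i) | i : 'I_m].
have cU : #|U| <= n + n.
  apply: leq_trans (leq_card_setU _ _) _; apply: leq_add;
  by apply: leq_trans (leq_imset_card _ _) _; rewrite card_ord ltnW.
have UA : U \subset A.
  by apply/subsetP => v /setUP[]/imsetP[i _ ->]; have [] := yz1 i (ltn_ord i).
have yU i : i < m -> y i \in U.
  by move=> im; rewrite inE; apply/orP; left; apply/imsetP; exists (Ordinal im).
have zU i : i < m -> z i \in U.
  by move=> im; rewrite inE; apply/orP; right; apply/imsetP; exists (Ordinal im).
pose I := [set v in A :\: U | [forall u in U, ~~ adj u v]].
have IP v : v \in I -> [/\ v \in A, v \notin U & {in U, forall u, ~~ adj u v}].
  by move=> /setIdP[/setDP[vA vU] /forall_inP h].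
(* An edge inside [I] would extend the matching, since [I] sees nothing of [U]. *)
have sI : stable I.
  move=> u v /IP[uA uU uN] /IP[vA vU vN]; apply/negP => uv; apply: mmax.
  pose y' i := if i < m then y i else u; pose z' i := if i < m then z i else v.
  exists y', z'; rewrite /y' /z'; split=> [i im|i j im jm ij].
    by case: ifP => [/yz1|].
  case: ifP => im'; case: ifP => jm'.
  - exact: yz2.
  - by rewrite uN ?vN ?yU ?zU.
  - by rewrite adj_sym uN ?yU // adj_sym uN ?zU // adj_sym vN ?zU.
  - by lia.
pose B := A :\: U :\: I.
have -> : d |: A = (d |: I) :|: (U :|: B).
  apply/setP => v; rewrite in_setU1 !in_setU in_set1 2!in_setD -orbA; congr (_ || _).
  have [vI|vI] /= := boolP (v \in I); first by have [->] := IP v vI.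
  have [vU|vU] /= := boolP (v \in U); rewrite -in_setU -/U.
    by rewrite vU (subsetP UA).
  by rewrite (negPf vU).
have IA : I \subset A by apply/subsetP => v /IP[].
apply: partableU.
- rewrite -setI_eq0; apply/eqP/setP => v; rewrite inE in_setU1 in_setU 2!in_setD in_set0.
  apply/negP => /andP[/orP[/eqP->|vI]].
    by rewrite (negPf dA) !andbF orbF => /(subsetP UA); apply/negP.
  by rewrite vI /= orbF; have [_ /negP] := IP v vI.
- by apply: partable_sp; apply: sp_star => //; apply: subset_trans IA Ad.
apply: (@partable_leq _ _ (#|U| * c)); first by rewrite leq_mul2r cU orbT.
(* What remains is dominated by [U]. A clique in the share of u grows by u itself inside [A], so the
   share has a smaller clique number and the induction applies. *)
apply: partable_assign.
- rewrite -setI_eq0; apply/eqP/setP => v; rewrite inE 2!in_setD in_set0.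
  by case: (v \in U); rewrite ?andbF.
- move=> v /setDP[/setDP[vA vU] vI]; apply: contrapT => h; case/negP: vI.
  rewrite in_set in_setD vA vU; apply/forall_inP => u uU; apply/negP => uv.
  by apply: h; exists u.
move=> u A' uU A'B A'u; apply: IH => // e; apply: KA.
apply: embeds_complete_cone A'u _ e; apply/subsetP => v /setU1P[->|];
  first exact: (subsetP UA).
by move/(subsetP A'B)/setDP => [/setDP[]].
Qed.

(** * Disjoint tubes and bounded partitions *)

Section PartitionBound.
Variable n : nat.
Hypothesis n0 : 0 < n.

Definition partition_class (G : sgraph) :=
  [/\ ~ embeds (complete_graph n) G, ~ embeds (Sstar n) G & ~ embeds (Stilde n) G] /\
  [/\ ~ embeds (F1 n) G, ~ embeds (F2 n) G, ~ embeds (F4 n) G & ~ embeds (F5 n) G].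

Section Tubes.
Variables (G : sgraph) (r : G) (f : G -> nat).
Hypotheses (fE : distance r f) (clG : partition_class G).

Lemma tube_eq p L v : geod f p L -> v \in tube f n p L -> v = p (f v).
Proof.
have [_ [_ _ F4G F5G]] := clG => gp; rewrite inE => /and3P[h1 h2 tv].
by apply: (twin_unique fE n0 F4G F5G gp) tv; lia.
Qed.

Lemma sp_tube p L : geod f p L -> n.*2 + 10 <= L -> sp (tube f n p L).
Proof.
move=> gp Ln; right; pose M := L - (n + 3) - (n + 3).
have ip := geod_ipath fE gp; have [pf _] := gp.
have -> : tube f n p L = [set (fun i => p (n + 3 + i)) (val i) | i : 'I_M.+1].
  apply/setP => v; apply/idP/imsetP => [vt|[i _ ->]].
    have e := tube_eq gp vt; move: vt; rewrite inE => /and3P[v1 v2 _].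
    have vM : f v - (n + 3) < M.+1 by rewrite /M; lia.
    by exists (Ordinal vM); rewrite //= subnKC.
  have := ltn_ord i; rewrite /M /= => iM; rewrite inE pf; last by lia.
  by rewrite (twin_self fE gp) ?andbT; lia.
apply: (@is_path_ipath _ (fun i => p (n + 3 + i)) M) => i j iM jM.
have [|| -> ->] := ip (n + 3 + i) (n + 3 + j); rewrite /M in iM jM; lia.
Qed.

(** By uniqueness of twins v lies on p, so p is among the twins of q at level f v and stays there
    both upwards and downwards. Hence the inclusion-maximal tubes are pairwise disjoint. *)
Lemma tube_nested p L q M v : geod f p L -> geod f q M -> L <= M ->
  v \in tube f n p L -> v \in tube f n q M -> tube f n p L \subset tube f n q M.
Proof.
move=> gp gq LM vp vq; have [_ [F1G F2G _ _]] := clG.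
have ev := tube_eq gp vp; apply/subsetP => u up; have eu := tube_eq gp up.
move: vp vq up; rewrite !inE => /and3P[vp1 vp2 _] /and3P[_ _ vt] /and3P[u1 u2 ut].
rewrite u1 (leq_trans u2 LM) /= {2}eu; rewrite {2}ev in vt.
have [h|h] := leqP (f v) (f u).
  by apply: (twin_up fE n0 F1G F2G gq gp _ _ _ vt); lia.
by apply: (twin_down fE n0 F1G F2G gq gp _ _ _ vt); lia.
Qed.

(** Every neighbour is a twin at one of three levels, and twins are unique. This bounds the new
    centres needed when a dominating vertex lies in a tube. *)
Lemma tube_nbh p L v : geod f p L -> v \in tube f n p L -> #|nbh v| <= 3.
Proof.
move=> gp; rewrite inE => /and3P[v1 v2 vt].
have [_ [F1G F2G F4G F5G]] := clG.
apply: leq_trans (_ : #|p (f v).-1 |: (p (f v) |: [set p (f v).+1])| <= _); last first.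
  by apply: leq_trans (leq_card_setU _ _) _;
    apply: leq_trans (leq_add (leqnn _) (leq_card_setU _ _)) _; rewrite !cards1.
apply: subset_leq_card; apply/subsetP => u; rewrite !inE => vu.
have ut : twin f p (f u) u by apply: (twin_adj fE n0 F1G F2G gp _ _ vt vu); lia.
have fu := dist_adj2 fE vu.
have -> : u = p (f u) by apply: (twin_unique fE n0 F4G F5G gp) ut; lia.
have : [|| f u == (f v).-1, f u == f v | f u == (f v).+1] by lia.
by case/or3P => /eqP->; rewrite eqxx ?orbT.
Qed.

End Tubes.

Lemma partition_bound : exists c, forall G : sgraph, connected G -> partition_class G ->
  partable [set: G] c.
Proof.
have [c1 c1P] := tube_structure n0; have [c2 c2P] := star_partition n n.
exists (c1 + (c1 + c1 * 3) * c2) => G conn clG; have [[KG SG StG] [F1G F2G F4G F5G]] := clG.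
have [r [f [Q [D [p [L [fE cQ cD QP hD]]]]]]] := c1P G conn KG SG F1G F2G.
pose W x := tube f n (p x) (L x); pose M := \bigcup_(x in Q) W x.
have -> : [set: G] = M :|: ~: M by rewrite setUCr.
apply: partableU; first by rewrite -setI_eq0 setICr.
  (* Only the maximal tubes are kept; they still cover [M], and two of them that meet are equal. *)
  pose F := W @: Q; exists [set S | maxset (mem F) S].
  have PF S : S \in [set S | maxset (mem F) S] -> S \in F.
    by rewrite inE => /maxsetP[].
  split.
  - move=> S /PF/imsetP[x xQ ->]; have [gp Ln] := QP x xQ.
    exact: (sp_tube fE clG gp Ln).
  - apply/setP => v; apply/bigcupP/bigcupP => [[S /PF/imsetP[x xQ ->] vW]|[x xQ vW]].
      by exists x.
    have WF : mem F (W x) by apply: imset_f.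
    have [S mS sS] := maxset_exists WF.
    by exists S; [rewrite inE | apply: (subsetP sS)].
  - apply/trivIsetP => S S' SP S'P ne; rewrite -setI_eq0; apply: contraNT ne.
    case/set0Pn => v /setIP[vS vS'].
    have /imsetP[x xQ eS] := PF _ SP; have /imsetP[x' xQ' eS'] := PF _ S'P.
    have [gx _] := QP x xQ; have [gx' _] := QP x' xQ'.
    move: SP S'P; rewrite !inE => /maxsetP[SF mS] /maxsetP[SF' mS'].
    have [h|/ltnW h] := leqP (L x) (L x').
      apply/eqP/esym; apply: mS => //; rewrite eS eS'; rewrite eS in vS; rewrite eS' in vS'.
      exact: (tube_nested fE clG gx gx' h vS vS').
    apply/eqP; apply: mS' => //; rewrite eS eS'; rewrite eS in vS; rewrite eS' in vS'.
    exact: (tube_nested fE clG gx' gx h vS' vS).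
  - apply: leq_trans (_ : #|F| <= _); first by apply: subset_leq_card; apply/subsetP.
    exact: leq_trans (leq_imset_card _ _) cQ.
(* Dominators inside [M] already belong to a path, so each is replaced by its at most three
   neighbours, which become centres themselves. *)
pose N := \bigcup_(d in D :&: M) nbh d; pose D' := (D :|: N) :\: M.
have cD' : #|D'| <= c1 + c1 * 3.
  apply: leq_trans (subset_leq_card (subsetDl _ _)) _.
  apply: leq_trans (leq_card_setU _ _) _; apply: leq_add => //.
  apply: leq_trans (leq_card_bigcup (c := 3) _) _.
    move=> d /setIP[_ /bigcupP[x xQ dW]]; have [gp _] := QP x xQ.
    exact: (tube_nbh fE clG gp dW).
  rewrite leq_mul2r; apply: leq_trans cD; exact: subset_leq_card (subsetIl _ _).
have -> : ~: M = D' :|: (~: M :\: D').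
  apply/setP => v; rewrite in_setU [in RHS]in_setD.
  by have [/setDP[_ vM]|_] := boolP (v \in D'); rewrite //= in_setC vM.
apply: (@partable_leq _ _ (#|D'| * c2)); first by rewrite leq_mul2r cD' orbT.
apply: partable_assign.
- rewrite -setI_eq0; apply/eqP/setP => v; rewrite inE in_setD in_set0.
  by case: (v \in D').
- move=> v /setDP[vM vD']; have [vD|[d dD dv]] := hD v vM.
    by case/negP: vD'; rewrite in_setD in_setU vD -in_setC vM.
  have [dM|dM] := boolP (d \in M); last by exists d; rewrite // in_setD in_setU dD dM.
  case/negP: vD'; rewrite in_setD in_setU -in_setC vM; apply/orP; right.
  by apply/bigcupP; exists d; rewrite inE // dD.
move=> u A _ _ Au; apply: c2P => // e; apply: KG.
exact: embeds_trans e (embeds_induced _).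
Qed.

End PartitionBound.

(** * Lower bounds *)

Section SPSets.
Variable G : sgraph.
Implicit Types S B : {set G}.

Lemma is_path_inv S : is_path (induced S) -> exists (q : nat -> G) (L : nat),
  ipath q L /\ {in S, forall v, exists2 i, i <= L & v = q i} /\
  (forall i, i <= L -> q i \in S).
Proof.
case=> -[//|L] _ [f [[g fK gK] fA]].
pose q i : G := val (g (inord i : 'I_L.+1)).
exists q, L; split; last split.
- move=> i j iL jL; rewrite /q; split.
    rewrite val_eqE (can_eq gK) -val_eqE /= !inordK //.
  transitivity (adj (g (inord i : 'I_L.+1)) (g (inord j : 'I_L.+1))) => //.
  by rewrite -fA !gK /= rel_adjE -val_eqE /= !inordK //; lia.
- move=> v vS; pose w : induced S := exist _ v vS.
  exists (val (f w : 'I_L.+1)); first by rewrite -ltnS; apply: (ltn_ord (f w : 'I_L.+1)).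
  by rewrite /q inord_val fK.
- by move=> i _; apply: valP.
Qed.

Lemma is_star_inv S : is_star (induced S) -> exists2 c, c \in S &
  {in S, forall v, v = c \/ adj c v} /\
  {in S &, forall u v, u != c -> v != c -> ~~ adj u v}.
Proof.
case=> m _ [f [[g fK gK] fA]].
have fN (v : induced S) : v != g None -> f v != None :> option 'I_m.
  by apply: contra => /eqP e; rewrite -[v]fK e.
exists (val (g None)); first exact: valP.
split=> [v vS|u v uS vS].
  pose w : induced S := exist _ v vS.
  have [<-|wN] := eqVneq w (g None); first by left.
  right; rewrite -[adj _ _]/(adj (g None) w) -fA gK /= rel_adjE /=.
  by have := fN w wN; case: (f w).
pose w : induced S := exist _ v vS; pose w' : induced S := exist _ u uS.
rewrite (_ : (u != _) = (w' != g None)) // (_ : (v != _) = (w != g None)) // => h1 h2.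
rewrite -[adj _ _]/(adj w' w) -fA /= rel_adjE /=.
by have := fN _ h1; have := fN _ h2; case: (f w); case: (f w') => //= *; rewrite andbF.
Qed.

(** For v in an induced path S these are exactly the interior vertices. *)
Definition inner S v := [exists a in S, exists b in S,
  [&& a != b, adj v a, adj v b & ~~ adj a b]].

Lemma innerP S v : reflect (exists a b, [/\ a \in S, b \in S & [/\ a != b, adj v a,
  adj v b & ~~ adj a b]]) (inner S v).
Proof.
apply: (iffP exists_inP) => [[a aS /exists_inP[b bS /and4P[]]]|[a [b [aS bS [h1 h2 h3 h4]]]]].
  by exists a, b.
by exists a => //; apply/exists_inP; exists b => //; apply/and4P.
Qed.

Lemma path_ends S : is_path (induced S) -> exists e1 e2,
  {in S, forall v, ~~ inner S v -> v \in [set e1; e2]}.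
Proof.
case/is_path_inv => q [L [qP [Sq qS]]]; exists (q 0), (q L) => v vS.
have [i iL ->] := Sq v vS; have [->|i0] := posnP i; first by rewrite !inE eqxx.
have [->|iL'] := eqVneq i L; first by rewrite !inE eqxx orbT.
case/innerP; exists (q i.-1), (q i.+1); split; try by apply: qS; lia.
by rewrite (qP _ _ _ _).1 ?(qP _ _ _ _).2; try lia; split; lia.
Qed.

Lemma sp_triangle S a b c : sp S -> a \in S -> b \in S -> c \in S ->
  adj a b -> adj a c -> adj b c -> False.
Proof.
move/sp_colorable => [col [h1 h2]] aS bS cS ab ac bc.
have := h1 a aS; have := h1 b bS; have := h1 c cS.
have := h2 a b aS bS ab; have := h2 a c aS cS ac; have := h2 b c bS cS bc; lia.
Qed.

Lemma sp_square S x x' y y' : sp S -> x \in S -> x' \in S -> y \in S -> y' \in S ->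
  x != x' -> y != y' -> adj x y -> adj x y' -> adj x' y -> adj x' y' -> False.
Proof.
case=> [/is_star_inv[c cS [_ h]]|/is_path_inv[q [L [qP [Sq _]]]]] xS x'S yS y'S xx' yy' a1 a2 a3 a4.
  have [u [uS uc uy uy']] : exists u, [/\ u \in S, u != c, adj u y & adj u y'].
    have [e|ne] := eqVneq x c; last by exists x.
    by exists x'; split=> //; rewrite -e eq_sym.
  have [e|ne] := eqVneq y c; last by have := h u y uS yS uc ne; rewrite uy.
  have ne : y' != c by rewrite -e eq_sym.
  by have := h u y' uS y'S uc ne; rewrite uy'.
have [i iL ei] := Sq x xS; have [i' iL' ei'] := Sq x' x'S.
have [j jL ej] := Sq y yS; have [j' jL' ej'] := Sq y' y'S.
move: xx' yy' a1 a2 a3 a4; rewrite ei ei' ej ej'.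
rewrite (qP _ _ iL iL').1 (qP _ _ jL jL').1 (qP _ _ iL jL).2 (qP _ _ iL jL').2.
by rewrite (qP _ _ iL' jL).2 (qP _ _ iL' jL').2; lia.
Qed.

Lemma card_set2_le (a b : G) : #|[set a; b]| <= 2.
Proof. by rewrite cards2; case: (a != b). Qed.

(** The vertices of B have complete neighbourhoods, so none is interior to an induced path, which
    leaves two ends. In a star, two leaves from B would be adjacent because of the centre, so at
    most one leaf and the centre are in B. *)
Lemma sp_simplicial S B : sp S ->
    {in B, forall v a b, adj v a -> adj v b -> a != b -> adj a b} ->
    {in S, forall c, {in B &, forall b b', b != b' -> adj c b -> adj c b' -> adj b b'}} ->
  #|S :&: B| <= 2.
Proof.
move=> spS sB cB; case: (spS) => [/is_star_inv[c cS [h1 h2]]|/path_ends[e1 [e2 h]]].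
  have [E0|/set0Pn[b /setD1P[bc /setIP[bS bB]]]] := eqVneq ((S :&: B) :\ c) set0.
    apply: leq_trans (_ : #|[set c]| <= _); last by rewrite cards1.
    by apply: subset_leq_card; rewrite -setD_eq0 E0.
  apply: leq_trans (card_set2_le c b); apply: subset_leq_card; apply/subsetP => v.
  move=> /setIP[vS vB]; rewrite !inE; have [//|vc /=] := eqVneq v c.
  apply: contraT => vb; have := h2 v b vS bS vc bc.
  case: (h1 v vS) => [e|cv]; first by rewrite e eqxx in vc.
  case: (h1 b bS) => [e|cb]; first by rewrite e eqxx in bc.
  by rewrite (cB c cS v b).
apply: leq_trans (card_set2_le e1 e2); apply: subset_leq_card; apply/subsetP => v.
move=> /setIP[vS vB]; apply: h => //; apply/innerP => -[a [b [aS bS [ab va vb /negP]]]].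
by apply; apply: sB va vb ab.
Qed.

Lemma cover_count (P : {set {set G}}) B t : cover P = [set: G] ->
  {in P, forall S, #|S :&: B| <= t} -> #|B| <= #|P| * t.
Proof.
move=> cP h; apply: leq_trans (leq_card_bigcup h); apply: subset_leq_card.
apply/subsetP => v vB; have : v \in cover P by rewrite cP inE.
by case/bigcupP => S SP vS; apply/bigcupP; exists S; rewrite // inE vS.
Qed.

Lemma inspc_coverable c : inspc G <= c <-> coverable [set: G] c.
Proof.
rewrite /inspc; case: ex_minnP => m /asboolP[P [h1 h2] cP] mmin; split=> [mc|].
  by exists P; split; rewrite ?h2 ?cP.
case=> Q [k1 k2 k3]; apply: leq_trans k3; apply: mmin; apply/asboolP; exists Q => //.
by split=> //; apply/eqP; rewrite eqEsubset subsetT.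
Qed.

Lemma inspp_partable c : inspp G <= c <-> partable [set: G] c.
Proof.
rewrite /inspp; case: ex_minnP => m /asboolP[P [[h1 h2] h3] cP] mmin; split=> [mc|].
  by exists P; split; rewrite ?h2 ?cP.
by case=> Q [k1 k2 k3 k4]; apply: leq_trans k4; apply: mmin; apply/asboolP; exists Q.
Qed.

Lemma partable_coverable A c : @partable G A c -> coverable A c.
Proof. by case=> P [h1 h2 h3 h4]; exists P; split; rewrite ?h2. Qed.

Lemma coverable_count c B t : coverable [set: G] c ->
  (forall S, sp S -> #|S :&: B| <= t) -> #|B| <= c * t.
Proof.
case=> P [h1 h2 h3] h; apply: leq_trans (_ : #|P| * t <= _);
  last by rewrite leq_mul2r h3 orbT.
apply: cover_count => [|S /h1]; last exact: h.
by apply/eqP; rewrite eqEsubset subsetT.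
Qed.

Lemma coverable_simplicial c B : coverable [set: G] c ->
    {in B, forall v a b, adj v a -> adj v b -> a != b -> adj a b} ->
    (forall c, {in B &, forall b b', b != b' -> adj c b -> adj c b' -> adj b b'}) ->
  #|B| <= c * 2.
Proof. by move=> cG h1 h2; apply: coverable_count cG _ => S spS; apply: sp_simplicial. Qed.

Lemma connected_root (x : G) : (forall v, connect (@adj G) x v) -> connected G.
Proof.
move=> h; split=> [|u v]; first by apply/card_gt0P; exists x.
by apply: connect_trans (h v); rewrite (sym_connect_sym (@adj_sym G)).
Qed.

End SPSets.

Lemma complete_connected n : 0 < n -> connected (complete_graph n).
Proof.
move=> n0; pose o : complete_graph n := Ordinal n0.
apply: (@connected_root _ o) => v; have [->|ne] := eqVneq v o; first exact: connect0.
by apply: connect1; rewrite /= rel_adjE /= eq_sym ne.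
Qed.

Lemma complete_cover n c : coverable [set: complete_graph n] c -> n <= c * 2.
Proof.
move/(coverable_simplicial (B := setT)); rewrite cardsT card_ord; apply.
  by move=> v _ a b _ _ ab; rewrite /= rel_adjE /= ab.
by move=> _ b b' _ _ bb' _ _; rewrite /= rel_adjE /= bb'.
Qed.

(** * The spiders [Sstar] and [Stilde] *)

Section Spiders.
Variable n : nat.
Hypothesis n0 : 0 < n.

Fact spider_x : X (Ordinal n0) \in first_x n 1. Proof. by rewrite inE. Qed.
Fact spider_y i : Y i \in first_x n 1. Proof. by rewrite inE. Qed.
Fact spider_z i : Z i \in first_x n 1. Proof. by rewrite inE. Qed.

Section Rel.
Variable F : rel (label n).
Hypothesis FXY : forall i j : 'I_n, i == 0 :> nat -> rel_adj F (X i) (Y j).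
Hypothesis FYZ : forall i j, rel_adj F (Y i) (Z j) = (i == j).

Let G := @induced (graph_of_rel F) (first_x n 1).
Let x : G := exist _ (X (Ordinal n0)) spider_x.
Let y i : G := exist _ (Y i) (spider_y i).
Let z i : G := exist _ (Z i) (spider_z i).

Lemma spider_connected : connected G.
Proof.
apply: (@connected_root G x) => -[v vS].
have cy i : connect (@adj G) x (y i) by apply: connect1; apply: FXY.
have yz i : adj (y i) (z i) by rewrite [adj _ _]FYZ.
case: v vS => i vS.
- rewrite (_ : exist _ _ _ = x) ?connect0 //; apply: val_inj => /=; congr X.
  by apply: ord_inj; move: vS; rewrite inE /=; lia.
- rewrite (_ : exist _ _ _ = y i) //; exact: val_inj.
- rewrite (_ : exist _ _ _ = z i); last exact: val_inj.
  exact: connect_trans (cy i) (connect1 (yz i)).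
Qed.

End Rel.

Lemma Sstar_connected : connected (Sstar n).
Proof.
by apply: spider_connected => [i j /eqP i0|i j]; rewrite rel_adjE ?labE /= ?i0 ?orbF.
Qed.

Lemma Stilde_connected : connected (Stilde n).
Proof.
by apply: spider_connected => [i j /eqP i0|i j];
  rewrite rel_adjE ?labE /Stilde_rel /= ?i0 ?orbF.
Qed.

Lemma Sstar_cover c : coverable [set: Sstar n] c -> n <= c * 2.
Proof.
pose z i : Sstar n := exist _ (Z i) (spider_z i).
have zI : injective z by move=> i j [].
have zadj i (v : Sstar n) : adj (z i) v -> val v = Y i.
  case: v => -[j|j|j] h; rewrite /= /induced_adj /= rel_adjE ?labE /=;
    try by rewrite ?andbF.
  by move/eqP->.
move/(coverable_simplicial (B := [set z i | i : 'I_n])); rewrite card_imset // card_ord;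
  apply.
- move=> _ /imsetP[i _ ->] a b /zadj ea /zadj eb.
  by rewrite -val_eqE ea eb eqxx.
- move=> c' _ _ /imsetP[i _ ->] /imsetP[j _ ->]; rewrite !(adj_sym c') => ne /zadj ei /zadj.
  by rewrite ei => -[e]; rewrite e eqxx in ne.
Qed.

(** Two stars centred at x and one path would cover everything, so disjointness is essential. Only
    one part S0 contains x, and it contains no triangle, so every i has a vertex [w i] outside S0.
    In the other parts, without x, no vertex is adjacent to two of the [w i]. *)
Lemma Stilde_partition c : partable [set: Stilde n] c -> n <= c * 2.
Proof.
case=> P [spP cP tP cardP].
pose x : Stilde n := exist _ (X (Ordinal n0)) spider_x.
pose y i : Stilde n := exist _ (Y i) (spider_y i).
pose z i : Stilde n := exist _ (Z i) (spider_z i).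
have xy i : adj x (y i) by rewrite /= /induced_adj /= rel_adjE ?labE /Stilde_rel.
have xz i : adj x (z i) by rewrite /= /induced_adj /= rel_adjE ?labE /Stilde_rel.
have yz i : adj (y i) (z i) by rewrite /= /induced_adj /= rel_adjE ?labE /Stilde_rel /= eqxx.
have yadj i (v : Stilde n) : adj (y i) v -> v = x \/ v = z i.
  case: v => -[j|j|j] h; rewrite /= /induced_adj /= rel_adjE ?labE /Stilde_rel /= ?andbF //.
    move=> j0; left; apply: val_inj => /=; congr X; apply: ord_inj => /=.
    by move: j0; lia.
  by rewrite !orbF => /eqP e; right; apply: val_inj; rewrite /= e.
have zadj i (v : Stilde n) : adj (z i) v -> v = x \/ v = y i.
  case: v => -[j|j|j] h; rewrite /= /induced_adj /= rel_adjE ?labE /Stilde_rel /= ?andbF //.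
    move=> j0; left; apply: val_inj => /=; congr X; apply: ord_inj => /=.
    by move: j0; lia.
  by rewrite !orbF => /eqP e; right; apply: val_inj; rewrite /= e.
have : x \in cover P by rewrite cP inE.
case/bigcupP => S0 S0P xS0.
pose w i := if y i \in S0 then z i else y i.
have wS0 i : w i \notin S0.
  rewrite /w; case: ifP => [yS|->//]; apply/negP => zS.
  exact: sp_triangle (spP _ S0P) xS0 yS zS (xy i) (xz i) (yz i).
have wI : injective w.
  by move=> i j; rewrite /w; case: ifP => _; case: ifP => _ // [].
have wadj i v : adj (w i) v -> v = x \/ v = y i \/ v = z i.
  by rewrite /w; case: ifP => _ => [/zadj|/yadj]; tauto.
have wsimp i a b : adj (w i) a -> adj (w i) b -> a != b -> adj a b.
  have yx : adj (y i) x by rewrite adj_sym.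
  have zx : adj (z i) x by rewrite adj_sym.
  by rewrite /w; case: ifP => _ => [/zadj[]-> /zadj[]->|/yadj[]-> /yadj[]->]; rewrite ?eqxx.
have := @cover_count _ P [set w i | i : 'I_n] 2 cP; rewrite card_imset // card_ord => h.
apply: leq_trans (h _) _; last by rewrite leq_mul2r.
move=> S SP; have [->|ne] := eqVneq S S0.
  rewrite (_ : _ :&: _ = set0) ?cards0 //; apply/setP => v; rewrite !inE.
  by apply/negP => /andP[vS0 /imsetP[i _ e]]; have := wS0 i; rewrite -e vS0.
have xS : x \notin S.
  have /trivIsetP/(_ S S0 SP S0P ne) d := tP; by rewrite (disjointFl d xS0).
apply: sp_simplicial (spP S SP) _ _ => [_ /imsetP[i _ ->]|u uS]; first exact: wsimp.
move=> _ _ /imsetP[i _ ->] /imsetP[j _ ->] ne'; rewrite !(adj_sym u) => ui uj.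
have ux : u <> x by move=> e; rewrite e (negPf xS) in uS.
have : i = j.
  by case: (wadj _ _ ui) => // -[]-> {ui} in ux uj *; case: (wadj _ _ uj) => // -[][].
by move=> e; rewrite e eqxx in ne'.
Qed.

End Spiders.

(** * Chains of gadgets sharing their legs *)

Section Chain.
Variables (M n k : nat) (F : rel (label n)).
Hypothesis kn : k <= n.

Definition chain_lab (s : 'I_k + 'I_n) : label n :=
  match s with inl i => X (widen_ord kn i) | inr t => Z t end.

(* (j, inl i) is the vertex x_i of the j-th gadget and (j, inr t) its z_t; the
   leg y of the gadget is the z-leg of the previous one, read backwards. *)
Definition chain_rel : rel ('I_M * ('I_k + 'I_n)) := fun u v =>
  (u.1 == v.1) && F (chain_lab u.2) (chain_lab v.2) ||
  (u.1 == v.1.+1 :> nat) &&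
    (if v.2 is inr t then rel_adj F (chain_lab u.2) (Y (rev_ord t)) else false).

Definition chain : sgraph := graph_of_rel chain_rel.

Lemma chain_lab_inj : injective chain_lab.
Proof.
by move=> [i|i] [j|j] //= [] => [e|->] //; congr inl; apply: ord_inj.
Qed.

Lemma chain_same j s s' : @adj chain (j, s) (j, s') = rel_adj F (chain_lab s) (chain_lab s').
Proof.
rewrite /chain /= !rel_adjE /chain_rel /= eqxx /= -pair_eqE /pair_eq /= eqxx (inj_eq chain_lab_inj).
by rewrite (_ : (j == j.+1 :> nat) = false) ?orbF //; lia.
Qed.

Lemma chain_next (j j' : 'I_M) s t : j = j'.+1 :> nat ->
  @adj chain (j, s) (j', inr t) = rel_adj F (chain_lab s) (Y (rev_ord t)).
Proof.
move=> e; have jj : (j == j') = false by rewrite -val_eqE /= e; lia.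
rewrite /chain /= rel_adjE /chain_rel /= jj (eq_sym j') jj /= e eqxx /=.
rewrite (_ : (j' == j'.+2 :> nat) = false) /= ?orbF; last by lia.
by rewrite (_ : (_ != _) = true) //; apply/eqP => -[ej _]; rewrite ej eqxx in jj.
Qed.

Lemma chain_adj u v : @adj chain u v ->
  [\/ u.1 = v.1,
      u.1 = v.1.+1 :> nat /\ exists t, v.2 = inr t |
      v.1 = u.1.+1 :> nat /\ exists t, u.2 = inr t].
Proof.
case: u v => [j s] [j' s'];
  rewrite /chain /= rel_adjE /chain_rel /= => /andP[_ /orP[]] /orP[]/andP[/eqP e].
- by constructor.
- by case: s' => // t _; constructor 2; split=> //; exists t.
- by constructor.
- by case: s => // t _; constructor 3; split=> //; exists t.
Qed.

Hypothesis n1 : 1 < n.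
Let n0 : 0 < n := ltnW n1.
Let o : 'I_n := Ordinal n0.

Hypothesis FXY : forall i j, rel_adj F (X i) (Y j) -> j == 0 :> nat.
Hypothesis FXZ : forall i j, rel_adj F (X i) (Z j) -> j == 0 :> nat.

Lemma chain_adjX j i v : @adj chain (j, inl i) v ->
  [\/ exists2 i', v = (j, inl i') & rel_adj F (X (widen_ord kn i)) (X (widen_ord kn i')),
      v = (j, inr o) |
      j = v.1.+1 :> nat /\ v.2 = inr (rev_ord o)].
Proof.
move=> a; case: (chain_adj a) => /= [e|[e [t et]]|[e [t //]]].
  case: v a e => j' [i'|t] a /= e; rewrite -e chain_same in a *.
    by constructor; exists i'.
  constructor 2; congr (_, inr _); apply: ord_inj; exact/eqP/(FXZ a).
constructor 3; split=> //; case: v a e et => j' s a /= e es;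
  rewrite es chain_next // in a *.
congr inr; rewrite -[t]rev_ordK; congr rev_ord; apply: ord_inj; exact/eqP/(FXY a).
Qed.

(** A leg vertex sees some x only if it is an end of its leg: the first vertex sees the gadget of
    the leg, the last one the next gadget, and they differ as n > 1. So a star meets the x of one
    gadget only. The index is a plain number since the next gadget may not exist. *)
Lemma chain_centre (c : chain) : exists j0 : nat, forall j i,
  c = (j, inl i) \/ @adj chain c (j, inl i) -> j = j0 :> nat.
Proof.
case: c => jc [ic|t].
  exists jc => j i [[->]|]; rewrite 1?adj_sym //.
  by case/chain_adjX => [[i' [->]]|[]|[_ ]].
exists (if t == o then (jc : nat) else jc.+1) => j i [//|].
rewrite adj_sym => /chain_adjX[[//]|[-> ->]|[/= e [et]]]; first by rewrite eqxx.
by rewrite ifF //; apply/eqP => /(congr1 val); rewrite et /=; lia.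
Qed.

Hypothesis FYY : forall i j, rel_adj F (Y i) (Y j) = (i.+1 == j) || (j.+1 == i).
Hypothesis FZZ : forall i j, rel_adj F (Z i) (Z j) = (i.+1 == j) || (j.+1 == i).
Hypothesis FYZ : forall i j, rel_adj F (Y i) (Z j) -> (i == 0 :> nat) && (j == 0 :> nat).
(* A graph with fewer than n vertices misses a vertex of every leg, and deleting
   one vertex from every leg separates the gadgets. *)
Lemma chain_local (H : sgraph) : connected H -> #|H| < n -> embeds H chain ->
  embeds H (@induced (graph_of_rel F) (first_x n k)).
Proof.
move=> [/card_gt0P[x0 _] conn] Hn [g [gI gA]].
have miss (j : 'I_M) : exists t : 'I_n, forall x, g x != (j, inr t).
  apply: contrapT => h; move: Hn; rewrite ltnNge => /negP; apply.
  have pre (t : 'I_n) : exists x, g x = (j, inr t).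
    apply: contrapT => h'; apply: h; exists t => x; apply/eqP => e; apply: h'; by exists x.
  have [q qP] := choice pre.
  rewrite -[n]card_ord; apply: (@leq_card _ _ q) => t t' e.
  by have := qP t; rewrite e qP => -[].
have [m mP] := choice miss.
(* Cut leg j at its missing vertex [m j]: the near part goes with gadget j, the far part with gadget
   j + 1. Edges of the image preserve this index, so it is constant on [H]. *)
pose rho (u : 'I_M * ('I_k + 'I_n)) : nat := match u with
  | (j, inl _) => j | (j, inr t) => if t < m j then nat_of_ord j else j.+1 end.
have mneq x j (t : 'I_n) : g x = (j, inr t) -> t != m j :> nat.
  by move=> e; apply: contraTneq (mP j x) => /ord_inj et; rewrite negbK e et.
have rho_adj x y : adj x y -> rho (g x) = rho (g y).
  rewrite -gA; wlog h : x y / (g x).1 = (g y).1 \/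
      (g x).1 = (g y).1.+1 :> nat /\ exists t, (g y).2 = inr t.
    move=> th a; case: (chain_adj a) => h; first by apply: th => //; left.
      by apply: th => //; right.
    by apply/esym; apply: th; rewrite 1?adj_sym //; right.
  case ex: (g x) => [j s]; case ey: (g y) => [j' s'] a; rewrite ex ey /= in h.
  case: h => [ej|[ej [t et]]]; rewrite /rho /=.
    rewrite -ej chain_same in a *; case: s s' ex ey a => [i|t] [i'|t'] ex ey /= a //.
    - have := FXZ a; have := mneq _ _ _ ey; rewrite -ej; case: ifP; lia.
    - have := FXZ (i := widen_ord kn i') (j := t); rewrite rel_adj_sym => /(_ a).
      by have := mneq _ _ _ ex; case: ifP; lia.
    - have := mneq _ _ _ ex; have := mneq _ _ _ ey; rewrite -ej; move: a; rewrite FZZ.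
      by case: ifP; case: ifP; lia.
  rewrite et chain_next // in a ey *; have ty := mneq _ _ _ ey.
  have tn := ltn_ord t; have mn := ltn_ord (m j').
  have [tl sj] : t = n.-1 :> nat /\ (if s is inr t' then t' == 0 :> nat else true).
    case: s a ex => [i|t'] /= a _.
      by have := FXY a => /=; split=> //; lia.
    have := FYZ (i := rev_ord t) (j := t'); rewrite rel_adj_sym => /(_ a) /=.
    by split; lia.
  rewrite (_ : t < m j' = false); last by lia.
  case: s sj ex {a} => [i|t'] //= /eqP t0 ex; have := mneq _ _ _ ex.
  by case: ifP; lia.
have rhoE x : rho (g x) = rho (g x0).
  have /connectP[p pp ->] := conn x0 x.
  elim: p (x0) pp => //= y p IH z /andP[zy yp]; rewrite (rho_adj _ _ zy); exact: IH.
pose j := rho (g x0).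
have gP x : (g x).1 = j :> nat \/ (g x).1.+1 = j /\ exists t, (g x).2 = inr t.
  have := rhoE x; rewrite -/j /rho; case: (g x) => [j' [i|t]] /=; first by left.
  by case: ifP => _ e; [left | right; split=> //; exists t].
(* The rest of the previous leg becomes the leg y read backwards; the final [chain_lab] is a default
   that [gP] excludes. *)
pose phi (u : 'I_M * ('I_k + 'I_n)) : label n := if u.1 == j :> nat
  then chain_lab u.2 else if u.2 is inr t then Y (rev_ord t) else chain_lab u.2.
apply: (@embeds_into _ (graph_of_rel F) _ (phi \o g)) => [x y|x y|x] /=; last first.
- by rewrite inE /phi; case: (g x) => [j' [i|t]] /=; case: ifP => //= _; apply: ltn_ord.
- rewrite -gA /phi; case ex: (g x) => [jx s]; case ey: (g y) => [jy s'] /=.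
  have := gP x; have := gP y; rewrite ex ey /=.
  rewrite -[rel_adj chain_rel _ _]/(@adj chain (jx, s) (jy, s')).
  case=> [hy|[hy [t et]]] [hx|[hx [t' et']]].
  + have e : jx = jy by apply: ord_inj; rewrite hx hy.
    by rewrite hx hy eqxx e chain_same.
  + rewrite hy eqxx ifF; last by lia.
    by rewrite et' adj_sym chain_next; [rewrite rel_adj_sym|lia].
  + rewrite hx eqxx ifF; last by lia.
    by rewrite et chain_next //; lia.
  + have e : jx = jy by apply: ord_inj; lia.
    rewrite !ifF; try lia; rewrite et et' e chain_same /= FYY FZZ /=.
    by have := ltn_ord t; have := ltn_ord t'; lia.
- move=> e; apply: gI; move: e; rewrite /phi; case ex: (g x) => [jx s];
    case ey: (g y) => [jy s'] /=.
  have := gP x; have := gP y; rewrite ex ey /=.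
  case=> [hy|[hy [t et]]] [hx|[hx [t' et']]].
  + have e : jx = jy by apply: ord_inj; rewrite hx hy.
    by rewrite hx hy eqxx e => /chain_lab_inj->.
  + rewrite hy eqxx ifF; last by lia.
    by rewrite et'; case: s' {ey}.
  + rewrite hx eqxx ifF; last by lia.
    by rewrite et; case: s {ex}.
  + have e : jx = jy by apply: ord_inj; lia.
    by rewrite !ifF; try lia;
      rewrite et et' e => /(congr1 (fun l => if l is Y i then i else o)) /rev_ord_inj->.
Qed.

Lemma chain_unavoidable (Hs : seq sgraph) :
    (forall H, List.In H Hs -> connected H) ->
    (forall H, List.In H Hs -> #|H| < n) -> ~ family_free Hs chain ->
  exists2 H, List.In H Hs &
    contains_induced (@induced (graph_of_rel F) (first_x n k)) H.
Proof.
move=> Hc Hn nfree; apply: contrapT => h; apply: nfree => H HH /contains_embeds e; apply: h.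
by exists H => //; apply/contains_embeds; apply: chain_local => //; [apply: Hc | apply: Hn].
Qed.

Hypothesis FX0 : rel_adj F (X o) (Y o) && rel_adj F (X o) (Z o).
Hypothesis FXc : forall i : 'I_n, i < k ->
  [|| i == o, rel_adj F (X i) (X o) | rel_adj F (X i) (Z o)].

Lemma chain_connected : 0 < M -> 0 < k -> connected chain.
Proof.
move=> M0 k0.
have csym := sym_connect_sym (@adj_sym chain).
have [FX0Y FX0Z] := andP FX0.
have legs (j : 'I_M) (t : 'I_n) : connect (@adj chain) (j, inr o) (j, inr t).
  case: t => t tn; elim: t tn => [|t IH] tn.
    by rewrite (_ : Ordinal tn = o) ?connect0 //; apply: ord_inj.
  apply: connect_trans (IH (ltnW tn)) (connect1 _).
  by rewrite chain_same /= FZZ /= eqxx.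
pose o' : 'I_k := Ordinal k0.
have oo : widen_ord kn o' = o by apply: ord_inj.
have xz (j : 'I_M) : connect (@adj chain) (j, inl o') (j, inr o).
  by apply: connect1; rewrite chain_same /= oo.
have base (j : 'I_M) : connect (@adj chain) (Ordinal M0, inr o) (j, inr o).
  case: j => j jM; elim: j jM => [|j IH] jM.
    by rewrite (_ : Ordinal jM = Ordinal M0) ?connect0 //; apply: ord_inj.
  apply: connect_trans (IH (ltnW jM)) _.
  apply: connect_trans (legs _ (rev_ord o)) _.
  apply: connect_trans (xz _); rewrite csym; apply: connect1.
  by rewrite chain_next //= rev_ordK oo.
apply: (@connected_root chain (Ordinal M0, inr o)) => -[j [i|t]].
  apply: connect_trans (base j) _; rewrite csym.
  have /or3P[e|a|a] := @FXc (widen_ord kn i) (ltn_ord i).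
  - rewrite (_ : i = o') //; apply: ord_inj; by move/eqP: e => /(congr1 val).
  - by apply: connect_trans (xz j); apply: connect1; rewrite chain_same /= oo.
  - by apply: connect1; rewrite chain_same.
exact: connect_trans (base j) (legs j t).
Qed.

End Chain.

(** * Chains need many stars and paths *)

Section ChainBounds.
Variables (M n : nat).
Hypothesis n1 : 1 < n.
Let o : 'I_n := Ordinal (ltnW n1).

(** The pendant vertices x_2 of the gadgets have degree one, and no vertex is adjacent to two of
    them. *)
Lemma F1_chain_cover c : coverable [set: @chain M n 2 (@F1_rel n) n1] c -> M <= c * 2.
Proof.
have hXY (i j : 'I_n) : rel_adj (@F1_rel n) (X i) (Y j) -> j == 0 :> nat.
  by rewrite !rel_adjE ?labE /F1_rel /=; lia.
have hXZ (i j : 'I_n) : rel_adj (@F1_rel n) (X i) (Z j) -> j == 0 :> nat.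
  by rewrite !rel_adjE ?labE /F1_rel /=; lia.
pose i1 : 'I_2 := @Ordinal 2 1 isT.
pose b j : @chain M n 2 (@F1_rel n) n1 := (j, inl i1).
have bI : injective b by move=> i j [].
have badj j v : adj (b j) v -> v = (j, inl ord0).
  move=> a; case: (chain_adjX n1 hXY hXZ a) => [[i e _]|e|[e1 e2]].
  - move: a; rewrite e chain_same /= rel_adjE ?labE /F1_rel /=;
      case: i e => [[|[|i]]] //= i2 _ _.
    by congr (_, inl _); apply: ord_inj.
  - by move: a; rewrite e chain_same /= rel_adjE ?labE /F1_rel.
  - case: v a e1 e2 => j' s' a /= e1 e2.
    by rewrite e2 chain_next in a.
move/(coverable_simplicial (B := [set b j | j : 'I_M])); rewrite card_imset // card_ord;
  apply.
- by move=> _ /imsetP[j _ ->] u v /badj-> /badj->; rewrite eqxx.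
- move=> u _ _ /imsetP[j _ ->] /imsetP[j' _ ->] ne uj uj'.
  have [j0 h] := chain_centre n1 hXY hXZ u; case/eqP: ne; congr b; apply: ord_inj.
  by rewrite (h j i1) ?(h j' i1) //; right.
Qed.

(** The counted vertices are the x_1: their neighbours y_1 and z_1 are adjacent, so they are never
    interior to a path. *)
Lemma F2_chain_cover c : coverable [set: @chain M n 1 (@F2_rel n) (ltnW n1)] c -> M <= c * 2.
Proof.
have hXY (i j : 'I_n) : rel_adj (@F2_rel n) (X i) (Y j) -> j == 0 :> nat.
  by rewrite !rel_adjE ?labE /F2_rel /=; lia.
have hXZ (i j : 'I_n) : rel_adj (@F2_rel n) (X i) (Z j) -> j == 0 :> nat.
  by rewrite !rel_adjE ?labE /F2_rel /=; lia.
pose b j : @chain M n 1 (@F2_rel n) (ltnW n1) := (j, inl ord0).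
have bI : injective b by move=> i j [].
have badj j v : adj (b j) v -> v = (j, inr o) \/ j = v.1.+1 :> nat /\ v.2 = inr (rev_ord o).
  move=> a; case: (chain_adjX n1 hXY hXZ a) => [[i e h]|e|[e1 e2]]; [|by left|by right].
  by move: h; rewrite rel_adjE ?labE /F2_rel /= andbF.
have tri (j j' : 'I_M) : j = j'.+1 :> nat ->
    @adj (@chain M n 1 (@F2_rel n) (ltnW n1)) (j, inr o) (j', inr (rev_ord o)).
  by move=> e; rewrite chain_next //= rev_ordK rel_adjE ?labE /F2_rel.
move/(coverable_simplicial (B := [set b j | j : 'I_M])); rewrite card_imset // card_ord;
  apply.
- move=> _ /imsetP[j _ ->] [u1 u2] [v1 v2] /badj hu /badj hv.
  case: hu => [->|[/= eu ->]]; case: hv => [->|[/= ev ->]]; rewrite ?eqxx //.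
  + by move=> _; apply: tri.
  + by move=> _; apply: etrans (adj_sym _ _) (tri _ _ eu).
  + by rewrite (_ : u1 = v1) ?eqxx //; apply: ord_inj; lia.
- move=> u _ _ /imsetP[j _ ->] /imsetP[j' _ ->] ne uj uj'.
  have [j0 h] := chain_centre n1 hXY hXZ u; case/eqP: ne; congr b; apply: ord_inj.
  by rewrite (h j ord0) ?(h j' ord0) //; right.
Qed.

Section FullGadgets.
Variables (k : nat) (F : rel (label n)) (kn : k <= n).
Hypothesis hXY : forall i j, rel_adj F (X i) (Y j) = (j == 0 :> nat).
Hypothesis hXZ : forall i j, rel_adj F (X i) (Z j) = (j == 0 :> nat).
Let hXY' i j : rel_adj F (X i) (Y j) -> j == 0 :> nat. Proof. by rewrite hXY. Qed.
Let hXZ' i j : rel_adj F (X i) (Z j) -> j == 0 :> nat. Proof. by rewrite hXZ. Qed.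
Let G := @chain M n k F kn.

Lemma full_adjX (j : 'I_M) (i : 'I_k) (v : G) : @adj G (j, inl i) v ->
  (exists i', v = (j, inl i')) \/
  [/\ v = (j, inr o) \/ j = v.1.+1 :> nat /\ v.2 = inr (rev_ord o) &
      forall i', @adj G (j, inl i') v].
Proof.
case/(chain_adjX n1 hXY' hXZ') => [[i' -> _]|->|[e1 e2]].
- by left; exists i'.
- by right; split=> [|i']; [left | rewrite chain_same /= hXZ].
- right; split=> [|i']; first by right.
  case: v e1 e2 => j' s' e1 e2; rewrite /= in e1 e2.
  by rewrite e2 chain_next //= rev_ordK hXY.
Qed.

Definition gadget_core (j : 'I_M) : {set G} := [set ((j, inl i) : G) | i : 'I_k].

(** If some x is interior, a neighbour of it on the path is a y_1 or z_1, which sees every x of the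
    gadget; but it has at most two neighbours on the path. Otherwise every x on the path is an end
    of it. *)
Lemma path_core (S : {set G}) j : is_path (induced S) ->
  (forall i i' : 'I_k, ~~ @adj G (j, inl i) (j, inl i')) -> #|S :&: gadget_core j| <= 2.
Proof.
move=> pS stab; have [e1 [e2 he]] := path_ends pS.
have [q [L [qP [Sq _]]]] := is_path_inv pS.
have [/existsP[v /andP[/setIP[vS vB] /innerP[a [_ [aS _ [_ va _ _]]]]]]|none] :=
    boolP [exists v, (v \in S :&: gadget_core j) && inner S v].
  have /imsetP[i _ ev] := vB; rewrite ev in va.
  have aN i' : @adj G (j, inl i') a.
    case: (full_adjX va) => [[i2 ea]|[_ //]]; by have := stab i i2; rewrite -ea va.
  have [t tL et] := Sq a aS.
  apply: leq_trans (card_set2_le (q t.-1) (q t.+1)); apply: subset_leq_card.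
  apply/subsetP => w /setIP[wS /imsetP[i' _ ew]]; have [t' t'L et'] := Sq w wS.
  have := aN i'; rewrite -ew et' et (qP _ _ t'L tL).2 !inE => /orP[]/eqP e.
    by rewrite -e /= eqxx.
  by rewrite e eqxx orbT.
apply: leq_trans (card_set2_le e1 e2); apply: subset_leq_card; apply/subsetP => w wSB.
have /setIP[wS _] := wSB; apply: he => //.
by apply: contra none => iw; apply/existsP; exists w; rewrite wSB.
Qed.

(* Two vertices x of a gadget that are interior to the paths containing them
   close up a 4-cycle with y_1 and z_1. *)
Lemma full_chain_partition c : k = 2 -> partable [set: G] c -> M <= c * 2.
Proof.
move=> k2 [P [spP cP tP cardP]].
have i0P : 0 < k by rewrite k2. have i1P : 1 < k by rewrite k2.
pose i0 : 'I_k := Ordinal i0P; pose i1 : 'I_k := Ordinal i1P.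
have iE (i : 'I_k) : i = i0 \/ i = i1.
  have := ltn_ord i; have [e|e] := posnP i; [left|right]; apply: ord_inj => /=; lia.
(* The gadgets of which S contains an x that is not interior in S: at most two through the ends of a
   path, at most one for a star. *)
pose J (S : {set G}) : {set 'I_M} := [set j | [exists i : 'I_k,
  (((j, inl i) : G) \in S) && ~~ inner S ((j, inl i) : G)]].
have cJ S : S \in P -> #|J S| <= 2.
  move/spP => -[/is_star_inv[u uS [h1 _]]|/path_ends[e1 [e2 he]]].
    have [j0 hu] := chain_centre n1 hXY' hXZ' u.
    apply: leq_trans (_ : 1 <= 2) => //; apply/card_le1_eqP => j j'.
    rewrite !inE => /existsP[i /andP[iS _]] /existsP[i' /andP[iS' _]].
    apply: ord_inj; rewrite (hu j i) ?(hu j' i') //; [case: (h1 _ iS') | case: (h1 _ iS)];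
      by [move=> <-; left|right].
  have h : J S \subset [set e1.1; e2.1].
    apply/subsetP => j; rewrite inE => /existsP[i /andP[iS iN]].
    by have := he _ iS iN; rewrite !inE => /orP[]/eqP<-; rewrite eqxx ?orbT.
  by apply: leq_trans (subset_leq_card h) _; rewrite cards2; case: (_ != _).
have all_j : \bigcup_(S in P) J S = setT.
  apply/setP => j; rewrite !inE; apply: contraT => njJ.
  have blk i : exists S, [/\ S \in P, ((j, inl i) : G) \in S & inner S ((j, inl i) : G)].
    have : ((j, inl i) : G) \in cover P by rewrite cP inE.
    case/bigcupP => S SP iS; exists S; split=> //; apply: contraNT njJ => iN.
    by apply/bigcupP; exists S => //; rewrite inE; apply/existsP; exists i; rewrite iS.
  (* The other x of the gadget sees both y_1 and z_1, so it cannot belong to a nonadjacent pair of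
     neighbours; the pair is y_1, z_1. Since z_1 is in both parts, they coincide. This works with or
     without the edge between the two x. *)
  have ends i S : inner S ((j, inl i) : G) -> ((j, inr o) : G) \in S /\
      exists y, [/\ y \in S, y != (j, inr o) & forall i', @adj G (j, inl i') y].
    case/innerP => a [b [aS bS [ab ia ib nab]]].
    case: (full_adjX ia) => [[ia' ea]|[ha ha']];
      case: (full_adjX ib) => [[ib' eb]|[hb hb']].
    + have ni : ia' != i by apply: contraTneq ia => e; rewrite ea e adj_irr.
      have ni' : ib' != i by apply: contraTneq ib => e; rewrite eb e adj_irr.
      case/negP: ab; rewrite ea eb; apply/eqP; congr (_, inl _).
      by move: ni ni'; case: (iE ia') => ->; case: (iE ib') => ->; case: (iE i) => ->;
        rewrite ?eqxx.
    + by case/negP: nab; rewrite ea.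
    + by case/negP: nab; rewrite eb adj_sym.
    + case: ha => [ea|[ea1 ea2]]; first by rewrite -ea; split=> //; exists b;
        rewrite eq_sym.
      case: hb => [eb|[eb1 eb2]]; first by rewrite -eb; split=> //; exists a.
      case/eqP: ab;
        case: a b ea1 ea2 eb1 eb2 {aS bS ia ib nab ha' hb'} => a1 a2 [b1 b2] /= e1 -> e2 ->.
      by congr (_, _); apply: ord_inj; lia.
  have [S [SP S0 /ends[zS [y [yS yz hy]]]]] := blk i0.
  have [S' [S'P S1 /ends[zS' _]]] := blk i1.
  have eS : S' = S.
    apply: contraTeq isT => ne; have /trivIsetP/(_ S' S S'P SP ne) d := tP.
    by rewrite (disjointFr d zS') in zS.
  have az i : @adj G (j, inl i) (j, inr o) by rewrite chain_same /= hXZ.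
  have ne01 : ((j, inl i0) : G) != (j, inl i1) by apply/eqP => -[].
  rewrite eS in S1.
  by case: (sp_square (spP _ SP) S0 S1 yS zS ne01 yz (hy i0) (az i0) (hy i1) (az i1)).
rewrite -(card_ord M) -cardsT -all_j.
apply: leq_trans (leq_card_bigcup cJ) _; by rewrite leq_mul2r cardP.
Qed.

End FullGadgets.

(** There are M n vertices x. A star meets one gadget, so at most n of them; a path meets each
    gadget at most twice, so at most 2 M of them, which is at most n. *)
Lemma F3_chain_cover c : M.*2 <= n ->
  coverable [set: @chain M n n (@F3_rel n) (leqnn n)] c -> M <= c.
Proof.
move=> Mn; pose G := @chain M n n (@F3_rel n) (leqnn n).
have hXY (i j : 'I_n) : rel_adj (@F3_rel n) (X i) (Y j) = (j == 0 :> nat).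
  by rewrite !rel_adjE ?labE /F3_rel /=; lia.
have hXZ (i j : 'I_n) : rel_adj (@F3_rel n) (X i) (Z j) = (j == 0 :> nat).
  by rewrite !rel_adjE ?labE /F3_rel /=; lia.
have hXY' i j : rel_adj (@F3_rel n) (X i) (Y j) -> j == 0 :> nat by rewrite hXY.
have hXZ' i j : rel_adj (@F3_rel n) (X i) (Z j) -> j == 0 :> nat by rewrite hXZ.
have hXX (j : 'I_M) (i i' : 'I_n) : ~~ @adj G (j, inl i) (j, inl i').
  by rewrite chain_same /= rel_adjE /F3_rel /= andbF.
pose B : {set G} := [set ((x.1, inl x.2) : G) | x : 'I_M * 'I_n].
have cB : #|B| = M * n.
  by rewrite card_imset ?card_prod ?card_ord // => -[i j] [i' j'] [-> ->].
move=> cG; suff : M * n <= c * n by rewrite leq_pmul2r // ltnW.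
rewrite -cB; apply: coverable_count cG _ => S [].
  case/is_star_inv => u uS [h1 _]; have [j0 hu] := chain_centre n1 hXY' hXZ' u.
  have gad j i : ((j, inl i) : G) \in S -> j = j0 :> nat.
    by move=> iS; apply: (hu j i); case: (h1 _ iS) => [->|]; [left | right].
  have [->|/set0Pn[v /setIP[vS /imsetP[[j i] _ ev]]]] := eqVneq (S :&: B) set0.
    by rewrite cards0.
  rewrite ev in vS; apply: leq_trans (_ : #|@gadget_core n (@F3_rel n) (leqnn n) j| <= _).
    apply: subset_leq_card; apply/subsetP => w /setIP[wS /imsetP[[j' i'] _ ew]].
    rewrite ew in wS; apply/imsetP; exists i' => //; rewrite ew /=; congr (_, _).
    by apply: ord_inj; rewrite (gad _ _ wS) (gad _ _ vS).
  by apply: leq_trans (leq_imset_card _ _) _; rewrite card_ord.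
move=> pS; apply: leq_trans Mn; rewrite -muln2 -[X in X * 2](card_ord M) -cardsT.
have h : {in [set: 'I_M], forall j, #|S :&: @gadget_core n (@F3_rel n) (leqnn n) j| <= 2}.
  by move=> j _; apply: path_core.
apply: leq_trans (leq_card_bigcup h).
  apply: subset_leq_card; apply/subsetP => w /setIP[wS /imsetP[[j' i'] _ ew]].
  apply/bigcupP; exists j'; rewrite // inE wS; apply/imsetP; by exists i'.
Qed.

End ChainBounds.

(** * The equivalences *)

Lemma family_free_embeds Hs Gs : family_le Hs Gs -> forall G, family_free Hs G ->
  forall X, List.In X Gs -> ~ embeds X G.
Proof.
move=> le G free X /le[H HH /contains_embeds HX] XG.
by apply: (free H HH); apply/contains_embeds; apply: embeds_trans HX XG.
Qed.

Lemma not_family_free Hs G : ~ family_free Hs G ->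
  exists2 H, List.In H Hs & contains_induced G H.
Proof.
by move=> nf; apply: contrapT => h; apply: nf => H HH c; apply: h; exists H.
Qed.

Lemma order_bound (Hs : seq sgraph) :
  exists m, forall H, List.In H Hs -> #|H| < m.
Proof.
elim: Hs => [|H Hs [m mP]]; first by exists 0.
exists (maxn m #|H|.+1) => H' [<-|/mP h]; rewrite leq_max ?leqnn ?orbT //.
by rewrite h.
Qed.

Section Necessity.
Variables (Hs : seq sgraph) (c n : nat).
Hypothesis Hconn : forall H, List.In H Hs -> connected H.
Hypothesis Hsize : forall H, List.In H Hs -> #|H| < n.
Hypothesis cn : (c * 2).+4 <= n.
Let n0 : 0 < n. Proof. by lia. Qed.
Let n1 : 1 < n. Proof. by lia. Qed.

Ltac gadget_rel := by move=> *;
  rewrite !rel_adjE ?labE ?/F1_rel ?/F2_rel ?/F5_rel ?/F3_rel /=; lia.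
Ltac gadget_imp := by move=> ? ?;
  rewrite !rel_adjE ?labE ?/F1_rel ?/F2_rel ?/F5_rel ?/F3_rel /=; lia.

Section Cover.
Hypothesis bound : forall G : sgraph, connected G -> family_free Hs G ->
  coverable [set: G] c.

Let unfree (G : sgraph) : connected G -> ~ coverable [set: G] c -> ~ family_free Hs G.
Proof. by move=> conn ncov free; apply: ncov; apply: bound. Qed.

Lemma complete_forced : exists2 H, List.In H Hs & contains_induced (complete_graph n) H.
Proof.
apply: not_family_free; apply: unfree (complete_connected n0) _.
by move/complete_cover; lia.
Qed.

Lemma Sstar_forced : exists2 H, List.In H Hs & contains_induced (Sstar n) H.
Proof.
apply: not_family_free; apply: unfree (Sstar_connected n0) _.
by move/Sstar_cover; lia.
Qed.

Lemma F1_forced : exists2 H, List.In H Hs & contains_induced (F1 n) H.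
Proof.
apply: (@chain_unavoidable (c * 2).+1 n 2 (@F1_rel n) n1 n1) => //;
  try gadget_rel; try gadget_imp.
apply: unfree => [|/F1_chain_cover]; last by lia.
by apply: (@chain_connected _ _ _ _ _ n1) => //; gadget_rel.
Qed.

Lemma F2_forced : exists2 H, List.In H Hs & contains_induced (F2 n) H.
Proof.
apply: (@chain_unavoidable (c * 2).+1 n 1 (@F2_rel n) n0 n1) => //;
  try gadget_rel; try gadget_imp.
apply: unfree => [|]; last by rewrite (bool_irrelevance n0 (ltnW n1)) => /F2_chain_cover;
  lia.
by apply: (@chain_connected _ _ _ _ _ n1) => //; gadget_rel.
Qed.

Lemma F3_forced : exists2 H, List.In H Hs & contains_induced (F3 n) H.
Proof.
suff [H HH /contains_embeds e] : exists2 H, List.In H Hs &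
    contains_induced (@induced (graph_of_rel (@F3_rel n)) (first_x n n)) H.
  by exists H => //; apply/contains_embeds; exact: embeds_trans e (embeds_induced _).
apply: (@chain_unavoidable c.+1 n n (@F3_rel n) (leqnn n) n1) => //;
  try gadget_rel; try gadget_imp.
apply: unfree => [|/(F3_chain_cover n1)]; last by lia.
by apply: (@chain_connected _ _ _ _ _ n1) => //; gadget_rel.
Qed.

End Cover.

Section Partition.
Hypothesis bound : forall G : sgraph, connected G -> family_free Hs G ->
  partable [set: G] c.

Let unfree (G : sgraph) : connected G -> ~ partable [set: G] c -> ~ family_free Hs G.
Proof. by move=> conn ncov free; apply: ncov; apply: bound. Qed.

Lemma Stilde_forced : exists2 H, List.In H Hs & contains_induced (Stilde n) H.
Proof.
apply: not_family_free; apply: unfree (Stilde_connected n0) _.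
by move/(Stilde_partition n0); lia.
Qed.

Lemma F4_forced : exists2 H, List.In H Hs & contains_induced (F4 n) H.
Proof.
apply: (@chain_unavoidable (c * 2).+1 n 2 (@F3_rel n) n1 n1) => //;
  try gadget_rel; try gadget_imp.
apply: unfree; first by apply: (@chain_connected _ _ _ _ _ n1) => //; gadget_rel.
move=> h; suff : (c * 2).+1 <= c * 2 by lia.
by apply: (full_chain_partition n1 _ _ _ h) => //; gadget_rel.
Qed.

Lemma F5_forced : exists2 H, List.In H Hs & contains_induced (F5 n) H.
Proof.
apply: (@chain_unavoidable (c * 2).+1 n 2 (@F5_rel n) n1 n1) => //;
  try gadget_rel; try gadget_imp.
apply: unfree; first by apply: (@chain_connected _ _ _ _ _ n1) => //; gadget_rel.
move=> h; suff : (c * 2).+1 <= c * 2 by lia.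
by apply: (full_chain_partition n1 _ _ _ h) => //; gadget_rel.
Qed.

End Partition.
End Necessity.

Theorem theorem1p2 (Hs : seq sgraph)
    (Hs_conn : forall H, List.In H Hs -> connected H) :
  ((exists c : nat, forall G : sgraph,
       connected G -> family_free Hs G -> inspc G <= c) <->
   (exists2 n : nat, 4 <= n &
      family_le Hs [:: complete_graph n; Sstar n; F1 n; F2 n; F3 n]))
  /\
  ((exists c : nat, forall G : sgraph,
       connected G -> family_free Hs G -> inspp G <= c) <->
   (exists2 n : nat, 4 <= n &
      family_le Hs [:: complete_graph n; Sstar n; Stilde n; F1 n; F2 n;
                       F4 n; F5 n])).
Proof.
have [m mP] := order_bound Hs.
(* n exceeds the order of every member of the family, exceeds the 2 c allowed by the lower bounds,
   and is at least 2 (c + 1) for the chain of c + 1 gadgets [F3]. *)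
have big c : exists2 n, 4 <= n & (forall H, List.In H Hs -> #|H| < n) /\ (c * 2).+4 <= n.
  exists (maxn m (c * 2).+4); first by lia.
  by split=> [H /mP h|]; lia.
split; split.
- case=> c bound; have [n n4 [nP cn]] := big c; exists n => //.
  have bd (G : sgraph) : connected G -> family_free Hs G -> coverable [set: G] c.
    by move=> conn free; apply/inspc_coverable; apply: bound.
  by move=> _ [<-|[<-|[<-|[<-|[<-|[]]]]]]; [apply: complete_forced cn bd
    | apply: Sstar_forced cn bd | apply: F1_forced cn bd | apply: F2_forced cn bd
    | apply: F3_forced cn bd].
- case=> n n4 le; have [c cP] := cover_bound (ltnW (ltnW (ltnW n4))).
  exists c => G conn free; apply/inspc_coverable; apply: cP => //.
  by have no := family_free_embeds le free; split; apply: no => /=; tauto.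
- case=> c bound; have [n n4 [nP cn]] := big c; exists n => //.
  have pbd (G : sgraph) : connected G -> family_free Hs G -> partable [set: G] c.
    by move=> conn free; apply/inspp_partable; apply: bound.
  (* A partition is a cover, so the graphs common to both lists are forced as before; only [Stilde],
     [F4] and [F5] rely on disjointness. *)
  have bd (G : sgraph) : connected G -> family_free Hs G -> coverable [set: G] c.
    by move=> conn free; apply: partable_coverable; apply: pbd.
  by move=> _ [<-|[<-|[<-|[<-|[<-|[<-|[<-|[]]]]]]]]; [apply: complete_forced cn bd
    | apply: Sstar_forced cn bd | apply: Stilde_forced cn pbd | apply: F1_forced cn bd
    | apply: F2_forced cn bd | apply: F4_forced cn pbd | apply: F5_forced cn pbd].
- case=> n n4 le; have [c cP] := partition_bound (ltnW (ltnW (ltnW n4))).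
  exists c => G conn free; apply/inspp_partable; apply: cP => //.
  by have no := family_free_embeds le free; split; split; apply: no => /=; tauto.
Qed.
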